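(* Let $A \in \widehat{\mathcal{C}}(X)$. Then the following assertions are equivalent: (i) $A$ is generalized Drazin-Riesz invertible; (ii) $0 \notin \operatorname{acc}\sigma_{b}(A)$.
   Context: $X$ is an infinite-dimensional complex Banach space; $\mathcal{C}(X)$ is the class of closed densely defined linear operators on $X$, $\mathcal{L}(X)$ the bounded linear operators on $X$; $\mathcal{N}(A),\mathcal{D}(A),\mathcal{R}(A)$ are the null space, domain and range. $\mathcal{D}(A^n)=\{x: x,Ax,\dots,A^{n-1}x\in\mathcal{D}(A)\}$. $A$ is Fredholm if $\mathcal{R}(A)$ is closed, $\dim\mathcal{N}(A)<\infty$ and $\operatorname{codim}\mathcal{R}(A)<\infty$; $A$ is Browder if it is Fredholm of finite ascent ($\mathcal{N}(A^n)=\mathcal{N}(A^{n+1})$ for some $n\ge 0$) and finite descent ($\mathcal{R}(A^n)=\mathcal{R}(A^{n+1})$ for some $n\ge0$). $\sigma_e(A)$ (resp. $\sigma_b(A)$) is the set of $\lambda\in\mathbb{C}$ such that $A-\lambda$ is not Fredholm (resp. not Browder), $\rho_e(A)=\mathbb{C}\setminus\sigma_e(A)$. $\operatorname{acc}K$ is the set of accumulation points of $K\subset\mathbb{C}$. $\widehat{\mathcal{C}}(X)$ is the set of $A\in\mathcal{C}(X)$ with $\rho_e(A)\neq\emptyset$ and $\mathcal{D}(A^{j+1})=\mathcal{D}(A^j)$ for all sufficiently large $j$. A bounded operator $T$ is Riesz if $\sigma_e(T)=\{0\}$. For $A\in\mathcal{C}(X)$, $B\in\mathcal{L}(X)$, $AB=BA$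 means $\mathcal{R}(B)\subset\mathcal{D}(A)$ and $BAx=ABx$ for all $x\in\mathcal{D}(A)$. $A\in\mathcal{C}(X)$ is (closed) generalized Drazin-Riesz invertible if there is $B\in\mathcal{L}(X)$ with $\mathcal{R}(B)\subset\mathcal{D}(A)$, $\mathcal{R}(I-AB)\subset\mathcal{D}(A)$, $BAB=B$, $AB=BA$ and $A(I-AB)$ bounded Riesz. *)

(* Defs.v *)
From HB Require Import structures.
From mathcomp Require Import all_boot all_order all_algebra.
From mathcomp Require Import complex.
From mathcomp Require Import boolp classical_sets reals topology normedtype.

Set Implicit Arguments.
Unset Strict Implicit.
Unset Printing Implicit Defensive.
Import Order.TTheory GRing.Theory Num.Theory.
Import numFieldNormedType.Exports.
Local Open Scope classical_set_scope.
Local Open Scope ring_scope.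

Section Dimension.
Context {K : numFieldType} {X : lmodType K}.

(** For a linear subspace [S], this says that [dim S] is finite. *)
Definition finite_dim (S : set X) : Prop :=
  exists (n : nat) (e : 'I_n -> X), (forall i, S (e i)) /\
    forall x, S x -> exists c : 'I_n -> K, x = \sum_(i < n) c i *: e i.

(** For a linear subspace [S], the classes of the [e i] span the quotient
    [X / S]. *)
Definition finite_codim (S : set X) : Prop :=
  exists (n : nat) (e : 'I_n -> X),
    forall x, exists c : 'I_n -> K, S (x - \sum_(i < n) c i *: e i).

End Dimension.

(** A linear operator defined on a linear subspace [dom] of [X]. The values of
    [opfun] outside [dom] are junk, and no notion below depends on them. *)
Record linop (K : numFieldType) (X : lmodType K) := LinOp {
  dom : set X;
  opfun :> X -> X;
  dom0 : dom 0;
  domP : forall a x y, dom x -> dom y -> dom (a *: x + y);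
  opfunP : forall a x y, dom x -> dom y ->
    opfun (a *: x + y) = a *: opfun x + opfun y
}.

Section Operators.
Context {K : numFieldType} {X : normedModType K}.
Implicit Types (A : linop X) (T : {linear X -> X}).

Definition op_null A : set X := [set x | dom A x /\ A x = 0].
Definition op_range A : set X := A @` dom A.

(** For [n = 0] these are those of the identity of [X]. *)
Definition dom_pow A (n : nat) : set X :=
  [set x | forall k, (k < n)%N -> dom A (iter k A x)].
Definition null_pow A (n : nat) : set X :=
  [set x | dom_pow A n x /\ iter n A x = 0].
Definition range_pow A (n : nat) : set X := iter n A @` dom_pow A n.

Definition closed_op A : Prop :=
  closed [set p : X * X | dom A p.1 /\ p.2 = A p.1].
Definition densely_defined A : Prop := dense (dom A).

Lemma op_shift_subproof A (l a : K) (x y : X) : dom A x -> dom A y ->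
  A (a *: x + y) - l *: (a *: x + y) =
    a *: (A x - l *: x) + (A y - l *: y).
Proof.
move=> Ax Ay; rewrite opfunP// scalerBr scalerDr !scalerA (mulrC l a).
by rewrite opprD addrACA.
Qed.

Definition op_shift A (l : K) : linop X :=
  LinOp (@dom0 _ _ A) (@domP _ _ A) (op_shift_subproof (A := A) l).

Definition op_of_linear T : linop X :=
  @LinOp K X setT T I (fun _ _ _ _ _ => I) (fun a x y _ _ => linearP T a x y).

(** Equivalent to [exists M, forall x, `|T x| <= M * `|x|], see
    [linear_boundedP]. *)
Definition bounded_op T : Prop := bounded_near T (nbhs (0 : X)).

Definition fredholm A : Prop :=
  [/\ closed (op_range A), finite_dim (op_null A) & finite_codim (op_range A)].
Definition finite_ascent A : Prop := exists n, null_pow A n = null_pow A n.+1.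
Definition finite_descent A : Prop :=
  exists n, range_pow A n = range_pow A n.+1.
Definition browder A : Prop :=
  [/\ fredholm A, finite_ascent A & finite_descent A].

Definition sigma_e A : set K := [set l | ~ fredholm (op_shift A l)].
Definition sigma_b A : set K := [set l | ~ browder (op_shift A l)].
Definition rho_e A : set K := ~` sigma_e A.

(** The class denoted by [C(X)] with a hat. *)
Definition hatC A : Prop :=
  [/\ closed_op A, densely_defined A, rho_e A !=set0 &
      exists N, forall j, (N <= j)%N -> dom_pow A j.+1 = dom_pow A j].

Definition riesz T : Prop :=
  bounded_op T /\ sigma_e (op_of_linear T) = [set 0].

(** [AB = BA] for [B] defined everywhere. *)
Definition op_commute A (B : {linear X -> X}) : Prop :=
  (forall x, dom A (B x)) /\ (forall x, dom A x -> B (A x) = A (B x)).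

(** The last component says that [A (I - A B)], which is defined everywhere,
    is a bounded Riesz operator. *)
Definition gen_drazin_riesz A : Prop :=
  exists B : {linear X -> X},
    [/\ bounded_op B,
        (forall x, dom A (B x)) /\ (forall x, dom A (x - A (B x))),
        (forall x, B (A (B x)) = B x),
        op_commute A B &
        exists T : {linear X -> X},
          (forall x, T x = A (x - A (B x))) /\ riesz T].

End Operators.

(* Main.v *)
Require Import Defs.
From HB Require Import structures.
From mathcomp Require Import all_boot all_order all_algebra.
From mathcomp Require Import complex.
From mathcomp Require Import boolp classical_sets reals topology normedtype.
From mathcomp Require Import prodnormedzmodule sequences.
From mathcomp Require Import ring lra zify.
Set Implicit Arguments.
Unset Strict Implicit.
Unset Printing Implicit Defensive.
Import Order.TTheory GRing.Theory Num.Theory.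
Import numFieldNormedType.Exports.
Local Open Scope ring_scope.
Local Open Scope complex_scope.

(** A Fredholm shift of [A] has a range of finite codimension in every power, so
    [D(A^(N+1)) = D(A^N)] makes [D(A)] of finite codimension; being the range of
    a closed relation it is closed, hence all of [X], and [A] is bounded. For a
    bounded [S], being Browder means being Fredholm and a limit of invertible
    [S - m], and then [S - m] is invertible for all small nonzero [m].

    (i) => (ii): with [E = A B], [A - l] is the product of [A (1 - E) - l] and of
    an operator that is invertible for small [l]. The first factor is Fredholm,
    and it is a limit of invertibles because the closure of the resolvent set of
    the Riesz operator [A (1 - E)] is open and closed in [C \ {0}].

    (ii) => (i): if [A] is not itself Browder, pick a small circle free of
    spectrum. The spectral projection of its inside is the limit of the averages
    of the resolvents over the [2^k]-th roots of unity on the circle; these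
    averages are [(1 - (A / r)^(2^k))^-1], so neither contour integrals nor
    functional calculus are needed. If [A] is Browder, split along [R(A^k)] and
    [N(A^k)] instead, which leaves a nilpotent, non-Fredholm operator. *)

(** The argument is arranged so as to avoid the Fredholm index. Being a limit of invertible shifts
    takes its place: unlike ascent and descent, that condition passes directly through commuting
    invertible factors and can be propagated along a ray.

    Analytically, almost everything rests on the open mapping theorem for closed relations. On the
    inverted graph of [A] it controls the domain; on restrictions of a bounded operator it yields
    lifts with uniform bounds, and such lifts survive small shifts by successive approximation.

    [riesz] asks for an essential spectrum equal to {0}, so in (ii) => (i) the operator
    [T = A (1 - A B)] must be shown not to be Fredholm. This explains the case distinction: with a
    circle, a Fredholm [T] would make [A] Browder, a contradiction only if [A] is not; if [A] is
    Browder, the kernel of [T] has finite codimension, and the infinite dimension of [X] decides.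

    Roots of unity of order [2^k] are used because doubling the order averages two earlier values,
    at [z] and at [eta z] with [eta] tending to 1 geometrically; Lipschitz dependence on [z] then
    gives convergence. *)

(** * Linear algebra *)

(* A reflexive normaliser for identities in a module: [lmod] compares the
   coefficients of each atom, up to [ring]. *)
Section ModuleNormaliser.
Context {K : comNzRingType} {V : lmodType K}.

Inductive lexp :=
  | LVar of nat | LZero | LOpp of lexp | LAdd of lexp & lexp
  | LScale of K & lexp.

Fixpoint leval (env : seq V) e : V := match e with
  | LVar i => nth 0 env i
  | LZero => 0
  | LOpp e => - leval env e
  | LAdd e f => leval env e + leval env f
  | LScale c e => c *: leval env e
  end.

(** [eqn] in place of [==] lets [cbn] evaluate the test on concrete indices. *)
Fixpoint lcoef e (i : nat) : K := match e with
  | LVar j => if eqn i j then 1 else 0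
  | LZero => 0
  | LOpp e => - lcoef e i
  | LAdd e f => lcoef e i + lcoef f i
  | LScale c e => c * lcoef e i
  end.

Lemma leval_coef env e :
  leval env e = \sum_(i < size env) lcoef e i *: nth 0 env i.
Proof.
elim: e => [j||e IH|e IHe f IHf|c e IH] /=.
- case: (ltnP j (size env)) => hj; last first.
    rewrite nth_default// big1// => i _; have -> : eqn i j = (i == j :> nat) by [].
    by rewrite ltn_eqF ?scale0r// (leq_trans (ltn_ord i)).
  rewrite (bigD1 (Ordinal hj))//= big1 ?addr0 => [|i].
    by have -> : eqn j j = (j == j) by []; rewrite eqxx scale1r.
  rewrite -val_eqE /= => ij; have -> : eqn i j = (i == j :> nat) by [].
  by rewrite (negPf ij) scale0r.
- by rewrite big1// => i _; rewrite scale0r.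
- by rewrite IH -sumrN; apply: eq_bigr => i _; rewrite scaleNr.
- by rewrite IHe IHf -big_split; apply: eq_bigr => i _; rewrite scalerDl.
- by rewrite IH scaler_sumr; apply: eq_bigr => i _; rewrite scalerA.
Qed.

Fixpoint lcoef_eq e f (k n : nat) : Prop := match n with
  | 0 => True
  | n'.+1 => lcoef e k = lcoef f k /\ lcoef_eq e f k.+1 n'
  end.

Lemma lcoef_eqP e f k n : lcoef_eq e f k n ->
  forall i, (k <= i < k + n)%N -> lcoef e i = lcoef f i.
Proof.
elim: n k => [k _ i|n IH k /= [ek /IH h] i]; first by lia.
have [-> //|ik] := eqVneq i k; move=> hi; apply: h.
by move/eqP: ik; lia.
Qed.

Lemma leval_eq env e f : lcoef_eq e f 0 (size env) -> leval env e = leval env f.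
Proof.
move=> /lcoef_eqP h; rewrite !leval_coef; apply: eq_bigr => i _.
by rewrite h// add0n ltn_ord.
Qed.

End ModuleNormaliser.

Ltac lmod_index x env := match env with
  | ?y :: _ => let _ := match goal with _ => unify x y end in constr:(0%N)
  | _ :: ?env' => let i := lmod_index x env' in constr:(S i)
  end.
Ltac lmod_insert x env := match goal with
  | _ => let _ := lmod_index x env in constr:(env)
  | _ => constr:(x :: env)
  end.
Ltac lmod_env K env t := lazymatch t with
  | GRing.add ?a ?b => let env' := lmod_env K env a in lmod_env K env' b
  | GRing.opp ?a => lmod_env K env a
  | GRing.scale _ ?a => lmod_env K env a
  | GRing.zero => constr:(env)
  | _ => lmod_insert t env
  end.
Ltac lmod_reify K env t := lazymatch t with
  | GRing.add ?a ?b => let a' := lmod_reify K env a in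
      let b' := lmod_reify K env b in constr:(@LAdd K a' b')
  | GRing.opp ?a => let a' := lmod_reify K env a in constr:(@LOpp K a')
  | GRing.scale ?c ?a => let a' := lmod_reify K env a in constr:(@LScale K c a')
  | GRing.zero => constr:(@LZero K)
  | _ => let i := lmod_index t env in constr:(@LVar K i)
  end.
Ltac lmod_goals K V := lazymatch goal with |- ?a = ?b =>
  let env := lmod_env K (@nil V) a in let env := lmod_env K env b in
  let a' := lmod_reify K env a in let b' := lmod_reify K env b in
  change (leval env a' = leval env b'); apply: leval_eq;
  cbn [lcoef_eq size lcoef eqn]; repeat split
  end.
Ltac lmod := lazymatch goal with R : realType |- @eq ?T _ _ =>
  lmod_goals R[i] T end; first [ring | field; by [|apply/andP; split]].

(** * Subspaces modulo finitely many vectors *)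

Section FiniteSpan.
Context {K : numFieldType} {V : lmodType K}.
Implicit Types (S U : set V) (s t : seq V).

Definition is_subspace S := S 0 /\ forall a x y, S x -> S y -> S (a *: x + y).

Lemma is_subspaceD S x y : is_subspace S -> S x -> S y -> S (x + y).
Proof. by move=> [_ h] /h Sx /Sx; move/(_ 1); rewrite scale1r. Qed.

Lemma is_subspaceZ S a x : is_subspace S -> S x -> S (a *: x).
Proof. by move=> [S0 h] /h Sx; rewrite -[_ *: _]addr0; apply: Sx. Qed.

Lemma is_subspaceN S x : is_subspace S -> S x -> S (- x).
Proof. by move=> sS Sx; rewrite -scaleN1r; apply: is_subspaceZ. Qed.

Lemma is_subspaceB S x y : is_subspace S -> S x -> S y -> S (x - y).
Proof. by move=> sS Sx Sy; apply: is_subspaceD => //; apply: is_subspaceN. Qed.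

Lemma is_subspaceI S U : is_subspace S -> is_subspace U ->
  is_subspace [set x | S x /\ U x]%classic.
Proof.
by move=> [? hS] [? hU]; split=> //= a x y [? ?] [? ?]; split; [exact: hS|exact: hU].
Qed.

(* [S + span s]; in particular [mspan [set 0] s] is the span of [s]. *)
Fixpoint mspan S s (x : V) : Prop :=
  if s is e :: s' then exists c : K, mspan S s' (x - c *: e) else S x.

Lemma mspanS S U s x : (forall y, S y -> U y) -> mspan S s x -> mspan U s x.
Proof.
move=> SU; elim: s x => [|e s IH] x /=; first exact: SU.
by move=> [c /IH]; exists c.
Qed.

Lemma mspan_cat S s t x : mspan S (s ++ t) x <-> mspan (mspan S t) s x.
Proof.
by elim: s x => [|e s IH] x //=; split=> -[c /IH h]; exists c.
Qed.

Lemma mspan_cons S e s x : mspan S (e :: s) x ->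
  mspan [set z | exists c, S (z - c *: e)]%classic s x.
Proof.
elim: s x => [|f s IH] x //= [c [d h]]; exists d; apply: IH; exists c.
by rewrite addrAC.
Qed.

Lemma mspan_sum S s x : mspan S s x <->
  exists c : nat -> K, S (x - \sum_(i < size s) c i *: nth 0 s i).
Proof.
elim: s x => [|e s IH] x /=.
  split=> [Sx|[c]]; last by rewrite big_ord0 subr0.
  by exists (fun=> 0); rewrite big_ord0 subr0.
split=> [[c /IH[d h]]|[c h]].
  exists (fun i => if i is i'.+1 then d i' else c).
  by rewrite big_ord_recl /= opprD addrA.
exists (c 0%N); apply/IH; exists (fun i => c i.+1).
by move: h; rewrite big_ord_recl /= opprD addrA.
Qed.

Lemma mspan_ord S n (e : 'I_n -> V) x :
  mspan S (mkseq (fun i => if insub i is Some j then e j else 0) n) x <->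
  exists c : 'I_n -> K, S (x - \sum_(i < n) c i *: e i).
Proof.
apply: (iff_trans (mspan_sum _ _ _)); rewrite size_mkseq.
split=> [[c h]|[c h]].
  exists (fun i => c i); move: h.
  by under eq_bigr do [rewrite nth_mkseq ?valK; last exact: ltn_ord].
exists (fun i => if insub i is Some j then c j else 0).
by under eq_bigr do [rewrite nth_mkseq ?valK; last exact: ltn_ord].
Qed.

Lemma mspan_nth S s x : mspan S s x <->
  exists c : 'I_(size s) -> K, S (x - \sum_(i < size s) c i *: nth 0 s i).
Proof.
rewrite -(mspan_ord S (fun i : 'I_(size s) => nth 0 s i)).
suff -> : mkseq (fun i => if insub i is Some j then nth 0 s (j : 'I_(size s)) else 0)
  (size s) = s by [].
apply: (@eq_from_nth _ 0); rewrite size_mkseq// => i hi.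
by rewrite nth_mkseq// insubT.
Qed.

Lemma finite_codimP S : finite_codim S <-> exists s, forall x, mspan S s x.
Proof.
split=> [[n [e h]]|[s h]].
  by eexists => x; apply/mspan_ord; exact: h.
by exists (size s), (fun i => nth 0 s i) => x; apply/mspan_nth.
Qed.

Lemma finite_dimP S : finite_dim S <-> exists s, (forall i, (i < size s)%N -> S (nth 0 s i)) /\
  forall x, S x -> mspan [set 0]%classic s x.
Proof.
split=> [[n [e [Se h]]]|[s [Ss h]]].
  exists (mkseq (fun i => if insub i is Some j then e j else 0) n); split.
    move=> i; rewrite size_mkseq => ni.
    by rewrite nth_mkseq// insubT; exact: Se.
  by move=> x /h[c ->]; apply/mspan_ord; exists c => /=; rewrite subrr.
exists (size s), (fun i => nth 0 s i); split=> [i|x /h/mspan_nth[c /= hc]].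
  exact: Ss.
by exists c; apply/eqP; rewrite -subr_eq0 hc.
Qed.

Lemma is_subspace_mspan S s : is_subspace S -> is_subspace (mspan S s).
Proof.
move=> sS; elim: s => [//|e s IH]; split=> [|a x y [c hc] [d hd]] /=.
  by exists 0; rewrite scale0r subr0; exact: IH.1.
exists (a * c + d); have := IH.2 a _ _ hc hd.
by rewrite scalerBr addrACA -opprD scalerA -scalerDl.
Qed.

(** Steinitz exchange. Induction handles the part of [U] in [S + span s]. A vector of [U] with a
    nonzero coefficient on [e] then replaces [e]; if there is none, [U] already lies in
    [S + span s]. *)
Lemma mspan_refine U S s : is_subspace U -> is_subspace S ->
  (forall x, U x -> mspan S s x) ->
  exists t, (forall i, (i < size t)%N -> U (nth 0 t i)) /\ forall x, U x -> mspan S t x.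
Proof.
move=> + sS; elim: s U => [|e s IH] U sU /= H; first by exists [::].
have sM := is_subspace_mspan s sS.
have [x [/= Ux Mx]|t [tU ht]] := IH _ (is_subspaceI sU sM); first exact: Mx.
have [[u [c [Uu c0 Mu]]]|nu] :=
    pselect (exists u c, [/\ U u, c != 0 & mspan S s (u - c *: e)]).
  exists (u :: t); split=> [[//|i] /= /tU[]//|x Ux /=].
  have [d Md] := H x Ux; exists (d / c); apply: ht; split.
    by apply: is_subspaceB => //; apply: is_subspaceZ.
  have := is_subspaceB sM Md (is_subspaceZ (d / c) sM Mu).
  by rewrite scalerBr scalerA divfK// opprB addrA subrK.
exists t; split=> [i /tU[]//|x Ux]; apply: ht; split => //.
have [d Md] := H x Ux; have [d0|d0] := eqVneq d 0.
  by move: Md; rewrite d0 scale0r subr0.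
by case: nu; exists x, d.
Qed.

(** [finite_dim] wants its spanning vectors inside the subspace, so the list for [S] has to be
    exchanged for one taken from [U]. *)
Lemma finite_dim_subset U S : is_subspace U -> (forall x, U x -> S x) ->
  finite_dim S -> finite_dim U.
Proof.
move=> sU US /finite_dimP[s [_ hs]]; apply/finite_dimP.
apply: (@mspan_refine U [set 0]%classic s) => //.
  by split=> //= a x y -> ->; rewrite scaler0 addr0.
by move=> x /US/hs.
Qed.

Lemma finite_codim_superset U S : (forall x, U x -> S x) ->
  finite_codim U -> finite_codim S.
Proof.
move=> US /finite_codimP[s hs]; apply/finite_codimP; exists s => x.
exact: mspanS US (hs x).
Qed.

Lemma finite_dim_codim S : finite_dim S -> finite_codim S ->
  finite_dim [set: V]%classic.
Proof.
move=> /finite_dimP[s [_ hs]] /finite_codimP[t ht].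
apply/finite_dimP; exists (t ++ s); split=> // x _; apply/mspan_cat.
exact: mspanS hs (ht x).
Qed.

(** By induction on the spanning list [e :: s], the traces of the chain on [M = span s] become
    stationary. Then either every [U n] has a vector outside [M], which serves to correct an element
    of [U m] into [M], or some [U n0] lies in [M]. *)
Lemma chain_stationary (U : nat -> set V) s : (forall n, is_subspace (U n)) ->
  (forall n x, U n.+1 x -> U n x) -> (forall x, U 0%N x -> mspan [set 0]%classic s x) ->
  exists m, forall n x, (m <= n)%N -> U m x -> U n x.
Proof.
elim: s U => [|e s IH] U sU dU /= U0.
  exists 0%N => n x _ /U0 ->; exact: (sU n).1.
have mono m n x : (m <= n)%N -> U n x -> U m x.
  elim: n => [|n IHn]; first by rewrite leqn0 => /eqP->.
  by rewrite leq_eqVlt => /orP[/eqP->//|mn /dU]; exact: IHn.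
have s0 : is_subspace [set (0 : V)]%classic.
  by split=> //= a x y -> ->; rewrite scaler0 addr0.
pose M := mspan [set 0]%classic s; have sM : is_subspace M := is_subspace_mspan s s0.
have [n|n x [/dU]|x []|m hm] := IH (fun n => [set x | U n x /\ M x]%classic).
- exact: is_subspaceI.
- by [].
- by [].
have [H|/existsNP[n0 H]] := pselect (forall n, exists u, U n u /\ ~ M u).
  exists m => n x mn Ux; have [u [Uu Mu]] := H n.
  have [c /= hc] := U0 u (mono 0%N n u isT Uu).
  have [d /= hd] := U0 x (mono 0%N m x isT Ux).
  have c0 : c != 0.
    by apply/eqP => c0; apply: Mu; move: hc; rewrite c0 scale0r subr0.
  have Umu := mono m n u mn Uu.
  have [|/= h _] := hm n (x - (d / c) *: u) mn.
    split; first by apply: (is_subspaceB (sU m)) => //; apply: is_subspaceZ.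
    have := is_subspaceB sM hd (is_subspaceZ (d / c) sM hc).
    by rewrite scalerBr scalerA divfK// opprB addrA subrK.
  rewrite -(subrK ((d / c) *: u) x); apply: is_subspaceD => //.
  exact: is_subspaceZ.
have HM x : U n0 x -> M x.
  by move=> Ux; apply: contrapT => Mx; apply: H; exists x.
exists (maxn m n0) => n x; rewrite geq_max => /andP[mn n0n] Ux.
have Mx : M x by apply: HM; apply: (mono _ (maxn m n0)) => //; rewrite leq_maxr.
have [] // := hm n x mn; split => //.
by apply: (mono _ (maxn m n0)) => //; rewrite leq_maxl.
Qed.

End FiniteSpan.

(** * The real-valued norm and compactness of the scalars *)

Section RealNorm.
Context {R : realType} {V : normedZmodType R[i]}.
Implicit Types x y z : V.

(** The norm takes its values in [R[i]]; its real part carries all of it and lives in the ordered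
    field [R], where [lra] applies. *)
Definition nm x : R := complex.Re `|x|.

Lemma nmE x : `|x| = (nm x)%:C.
Proof. by rewrite /nm RRe_real// normr_real. Qed.

Lemma nm_ge0 x : 0 <= nm x.
Proof. by have := normr_ge0 x; rewrite nmE lecR. Qed.

Lemma nm_eq0 x : nm x = 0 -> x = 0.
Proof. by move=> h; apply/eqP; rewrite -normr_eq0 nmE h. Qed.

Lemma nm_gt0 x : x != 0 -> 0 < nm x.
Proof.
move=> x0; rewrite lt_neqAle nm_ge0 andbT eq_sym.
by apply: contra_neq x0 => /nm_eq0.
Qed.

Lemma nm0 : nm (0 : V) = 0.
Proof. by rewrite /nm normr0. Qed.

Lemma nmD x y : nm (x + y) <= nm x + nm y.
Proof. by have := ler_normD x y; rewrite !nmE -rmorphD lecR. Qed.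

Lemma nmN x : nm (- x) = nm x.
Proof. by rewrite /nm normrN. Qed.

Lemma nmBC x y : nm (x - y) = nm (y - x).
Proof. by rewrite -nmN opprB. Qed.

Lemma nmB x y : nm (x - y) <= nm x + nm y.
Proof. by rewrite -(nmN y) nmD. Qed.

Lemma nm_tri x y z : nm (x - z) <= nm (x - y) + nm (y - z).
Proof. by rewrite (le_trans _ (nmD _ _))// addrA subrK. Qed.

Lemma nm_sub x y : nm x <= nm y + nm (x - y).
Proof. by rewrite (le_trans _ (nmD _ _))// addrC subrK. Qed.

Lemma nm_small0 x : (forall e, 0 < e -> nm x <= e) -> x = 0.
Proof.
move=> h; apply: nm_eq0; apply/eqP; rewrite eq_le nm_ge0 andbT leNgt.
by apply/negP => x0; have := h (nm x / 2) ltac:(lra); lra.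
Qed.

End RealNorm.

Section RealNormMore.
Context {R : realType}.
Implicit Types a b : R[i].

Lemma nmM a b : nm (a * b) = nm a * nm b.
Proof. by apply: complexI; rewrite -nmE normrM !nmE rmorphM. Qed.

Lemma nm1 : nm (1 : R[i]) = 1.
Proof. by rewrite /nm normr1. Qed.

Lemma nmX a n : nm (a ^+ n) = nm a ^+ n.
Proof. by elim: n => [|n IH]; rewrite ?expr0 ?nm1// !exprS nmM IH. Qed.

Lemma nmV a : nm a^-1 = (nm a)^-1.
Proof. by apply: complexI; rewrite -nmE normfV nmE fmorphV. Qed.

Lemma nm_real (r : R) : 0 <= r -> nm (r%:C) = r.
Proof. by move=> r0; rewrite /nm ger0_norm// lecR. Qed.

Lemma nmZ (X : normedModType R[i]) a (x : X) : nm (a *: x) = nm a * nm x.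
Proof. by apply: complexI; rewrite -nmE normrZ !nmE rmorphM. Qed.

Lemma nm_ReIm a : nm a <= `|complex.Re a| + `|complex.Im a|.
Proof.
case: a => a b /=; apply: (@le_trans _ _ (nm a%:C + nm ('i * b%:C))).
  by rewrite {1}(complexE (a +i* b)) nmD.
have nmR (c : R) : nm c%:C = `|c|.
  by rewrite /nm normc_def /= expr0n /= addr0 sqrtr_sqr.
rewrite nmM !nmR; suff -> : nm ('i : R[i]) = 1 by rewrite mul1r.
by rewrite /nm normc_def /= expr0n /= add0r expr1n sqrtr1.
Qed.

Lemma Re_le_nm a : `|complex.Re a| <= nm a.
Proof. by rewrite -lecR -nmE normc_ge_Re. Qed.

Lemma Im_le_nm a : `|complex.Im a| <= nm a.
Proof.
have := Re_le_nm (a * 'i); rewrite ReiNIm normrN nmM.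
suff -> : nm ('i : R[i]) = 1 by rewrite mulr1.
by rewrite /nm normc_def /= expr0n /= add0r expr1n sqrtr1.
Qed.

(** Bolzano-Weierstrass, from the compactness of a square; arbitrarily late visits near [l] replace
    a convergent subsequence. *)
Lemma bounded_cluster (u : nat -> R[i]) M : (forall n, nm (u n) <= M) ->
  exists l, forall e N, 0 < e -> exists n, (N <= n)%N /\ nm (u n - l) < e.
Proof.
move=> uM; pose v n := (complex.Re (u n), complex.Im (u n)).
have cA := @compact_setX R R _ _ (@segment_compact _ (- M) M)
   (@segment_compact _ (- M) M).
have vA : (v @ \oo)%classic (`[(- M), M] `*` `[(- M), M])%classic.
  exists 0%N => // n _; rewrite /= !in_itv /= -!ler_norml.
  by rewrite (le_trans (Re_le_nm _) (uM n)) (le_trans (Im_le_nm _) (uM n)).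
have [[a b] [_ cl]] := cA (v @ \oo)%classic _ vA.
exists (a +i* b) => e N e0.
have tl : (v @ \oo)%classic [set p | exists n, (N <= n)%N /\ p = v n]%classic.
  by exists N => // n /= Nn; exists n.
have bl : nbhs (a, b) (ball (a, b) (e / 2)) by apply: nbhsx_ballx; lra.
have [p [[n [Nn ->]] [/= b1 b2]]] := cl _ _ tl bl.
exists n; split => //; apply: (le_lt_trans (nm_ReIm _)).
move: b1 b2; rewrite /v /ball /= distrC (distrC b).
by case: (u n) => c d /=; lra.
Qed.

End RealNormMore.

(** * Completeness and closedness *)

Lemma gt0_complex {R : realType} (e : R[i]) : 0 < e ->
  e = (complex.Re e)%:C /\ 0 < complex.Re e.
Proof.
move=> e0; have eE : (complex.Re e)%:C = e by rewrite RRe_real ?gtr0_real.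
by split; rewrite -?ltcR eE.
Qed.

Section Sequences.
Context {R : realType} {X : completeNormedModType R[i]}.
Implicit Types (u : nat -> X) (q M e : R).

Lemma expr_small q M e : 0 <= q < 1 -> 0 < e ->
  exists N, forall n, (N <= n)%N -> M * q ^+ n < e.
Proof.
move=> /andP[q0 q1] e0; have M1 : 0 < `|M| + 1 by have := normr_ge0 M; lra.
have bl : nbhs (0 : R) (ball 0 (e / (`|M| + 1))).
  by apply: nbhsx_ballx; rewrite divr_gt0.
have [|N _ hN] := cvg_expr (z := q) _ bl; first by rewrite ger0_norm.
exists N => n Nn; have /= := hN n Nn.
rewrite /ball /= sub0r normrN ger0_norm ?exprn_ge0// ltr_pdivlMr// => h.
apply: le_lt_trans h; rewrite mulrC ler_wpM2l ?exprn_ge0//.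
by have := ler_norm M; lra.
Qed.

Lemma cvg_nm u : (forall e, 0 < e -> exists N, forall n, (N <= n)%N ->
    nm (u n - u N) < e) ->
  exists l, forall e, 0 < e -> exists N, forall n, (N <= n)%N -> nm (u n - l) < e.
Proof.
move=> cu.
have : cvg (u @ \oo)%classic.
  apply: cauchy_cvg; apply: cauchy_exP => e /gt0_complex[-> /cu[N hN]].
  exists (u N); exists N => // n /= /hN.
  by rewrite -ball_normE /= nmE ltcR nmBC.
move=> cvu; exists (lim (u @ \oo)%classic) => e e0.
have bl : nbhs (lim (u @ \oo)%classic) (ball (lim (u @ \oo)%classic) (e%:C)).
  by apply: nbhsx_ballx; rewrite ltcR.
have [N _ hN] := cvu _ bl; exists N => n Nn; have /= := hN n Nn.
by rewrite -ball_normE /= nmE ltcR nmBC.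
Qed.

Lemma geom_cvg u M q : 0 <= q < 1 ->
  (forall k, nm (u k.+1 - u k) <= M * q ^+ k) ->
  exists l, forall k, nm (u k - l) <= M * q ^+ k / (1 - q).
Proof.
move=> /andP[q0 q1] hu; have q1' : 0 < 1 - q by lra.
have M0 : 0 <= M by have := hu 0%N; rewrite expr0 mulr1; apply: le_trans (nm_ge0 _).
have tele k j : nm (u (k + j)%N - u k) <= M * q ^+ k / (1 - q) * (1 - q ^+ j).
  elim: j => [|j IH]; first by rewrite addn0 subrr nm0 expr0 subrr mulr0.
  rewrite addnS; apply: (le_trans (nm_tri _ (u (k + j)%N) _)).
  apply: (le_trans (lerD (hu _) IH)).
  rewrite exprD exprS.
  suff -> : M * (q ^+ k * q ^+ j) + M * q ^+ k / (1 - q) * (1 - q ^+ j) =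
     M * q ^+ k / (1 - q) * (1 - q * q ^+ j) by [].
  by field; rewrite gt_eqF.
have bnd k j : nm (u (k + j)%N - u k) <= M * q ^+ k / (1 - q).
  apply: (le_trans (tele k j)); rewrite ler_piMr//.
    by rewrite divr_ge0 ?mulr_ge0 ?exprn_ge0// ltW.
  by rewrite lerBlDr lerDl exprn_ge0.
have [e e0|l hl] := @cvg_nm u.
  have [|N hN] := @expr_small q (M / (1 - q)) e _ e0; first by rewrite q0.
  exists N => n Nn; rewrite -(subnKC Nn); apply: (le_lt_trans (bnd _ _)).
  by rewrite mulrAC hN.
exists l => k; rewrite leNgt; apply/negP => hk.
have [|N hN] := hl (nm (u k - l) - M * q ^+ k / (1 - q)); first lra.
have := hN (k + N)%N (leq_addl _ _).
have := bnd k N; have := nm_tri (u k) (u (k + N)%N) l.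
by rewrite (nmBC (u k) (u (k + N)%N)); lra.
Qed.

End Sequences.

Section Closed.
Context {R : realType} {V : normedModType R[i]}.
Implicit Types S : set V.

Lemma closed_nmP S : closed S <->
  forall z, (forall e : R, 0 < e -> exists y, S y /\ nm (z - y) < e) -> S z.
Proof.
split=> [cS z h|h z cz].
  apply: cS => B /nbhs_ballP[e /= /gt0_complex[-> /h[y [Sy zy]]]].
  rewrite -ball_normE => eB; exists y; split => //.
  by apply: eB => /=; rewrite nmE ltcR.
apply: h => e e0; have bl : nbhs z (ball z e%:C).
  by apply: nbhsx_ballx; rewrite ltcR.
have [y [Sy]] := cz _ bl; rewrite -ball_normE /= nmE ltcR => zy.
by exists y.
Qed.

(* Rescaling makes the coefficients of approximants bounded, and a cluster
   point of them is the coefficient of the limit. *)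
Lemma closed_add_line S v : is_subspace S -> closed S ->
  closed [set z | exists c : R[i], S (z - c *: v)]%classic.
Proof.
move=> sS /closed_nmP cS; apply/closed_nmP => z hz /=.
have [Sv|Sv] := pselect (S v).
  exists 0; rewrite scale0r subr0; apply: cS => e /hz[y [[c Sc] zy]].
  exists y; split => //; rewrite -(subrK (c *: v) y); apply: is_subspaceD => //.
  exact: is_subspaceZ.
(* [d] bounds from below the distance from [v] to the closed subspace [S]; this is what bounds the
   coefficients. *)
have [d [d0 dv]] : exists d : R, 0 < d /\ forall y, S y -> d <= nm (v - y).
  apply: contrapT => nd; apply: Sv; apply: cS => e e0.
  apply: contrapT => ny; apply: nd; exists e; split => // y Sy.
  by rewrite leNgt; apply/negP => ?; apply: ny; exists y.
have dc y c : S y -> d * nm c <= nm (y + c *: v).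
  move=> Sy; have [->|c0] := eqVneq c 0.
    by rewrite nm0 mulr0 nm_ge0.
  have -> : y + c *: v = c *: (v - (- c^-1 *: y)).
    by rewrite scaleNr opprK scalerDr scalerA mulfV// scale1r addrC.
  by rewrite nmZ mulrC ler_wpM2l ?nm_ge0// dv//; apply: is_subspaceZ.
have /choice[w hw] : forall n, exists w, exists c : R[i],
    S (w - c *: v) /\ nm (z - w) < (n.+1%:R)^-1.
  move=> n; have [|w [[c Sc] zw]] := hz (n.+1%:R)^-1.
    by rewrite invr_gt0 ltr0n.
  by exists w, c.
have /choice[c hc] := hw.
have [n|l hl] := @bounded_cluster R c ((nm z + 1) / d).
  rewrite ler_pdivlMr// mulrC; apply: (le_trans (dc _ _ (hc n).1)).
  rewrite subrK; have := nm_sub (w n) z; rewrite nmBC => h.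
  apply: (le_trans h); rewrite lerD2l; apply: ltW; apply: (lt_le_trans (hc n).2).
  by rewrite invf_le1 ?ltr0n// ler1n.
exists l; apply: cS => e e0.
pose e' := e / (1 + nm v).
have v1 : 0 < 1 + nm v by have := nm_ge0 v; lra.
have e'0 : 0 < e' by rewrite divr_gt0.
have [N hN] : exists N : nat, (N.+1%:R)^-1 < e'.
  have [N /= hN] := ltr_add_invr e'0.
  by exists N; rewrite add0r in hN.
have [n [Nn cn]] := hl e' N e'0.
exists (w n - c n *: v); split; first exact: (hc n).1.
have -> : z - l *: v - (w n - c n *: v) = (z - w n) + (c n - l) *: v.
  by lmod.
apply: (le_lt_trans (nmD _ _)); rewrite nmZ.
have zw : nm (z - w n) < e'.
  apply: (lt_trans (hc n).2); apply: (le_lt_trans _ hN).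
  by rewrite lef_pV2 ?posrE ?ltr0n// ler_nat ltnS.
have -> : e = e' + e' * nm v.
  by rewrite /e' -{1}[e / _]mulr1 -mulrDr mulfVK// gt_eqF.
by apply: ltr_leD => //; rewrite ler_wpM2r ?nm_ge0 ?ltW.
Qed.

End Closed.

(** * Open mapping theorem for closed linear relations *)

Section Pairs.
Context {R : realType} {X Y : normedModType R[i]}.
Implicit Types (x : X) (y : Y).

Lemma nm_pair x y : nm (x, y) = Num.max (nm x) (nm y).
Proof.
apply: complexI; rewrite -nmE prod_normE /= !nmE /Num.max ltcR.
by have [] := ltP (nm x) (nm y).
Qed.

Lemma nm_pair_lt x y (e : R) : (nm (x, y) < e) = (nm x < e) && (nm y < e).
Proof. by rewrite nm_pair gt_max. Qed.

End Pairs.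

Section OpenMapping.
Context {R : realType} {X Y : completeNormedModType R[i]}.
Implicit Types (G : set (X * Y)) (W : set Y).

Definition rng G : set Y := [set y | exists x, G (x, y)]%classic.

Lemma is_subspace_rng G : is_subspace G -> is_subspace (rng G).
Proof.
move=> [G0 sG]; split=> [|a y y' [x Gx] [x' Gx']]; first by exists 0.
by exists (a *: x + x'); apply: (sG a _ _ Gx Gx').
Qed.

(* Successive approximation: an approximate solution of [G x = y], up to a
   residual of half the size, can be corrected to an exact one. *)
Lemma approx_solve G W (C : R) : is_subspace G -> closed G -> 0 <= C ->
  (forall y, W y -> exists x y', [/\ G (x, y'), nm x <= C * nm y,
     nm (y - y') <= nm y / 2 & W (y - y')]) ->
  forall y, W y -> exists x, G (x, y) /\ nm x <= 2 * C * nm y.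
Proof.
move=> sG /closed_nmP cG C0 H y0 Wy0.
have /choice[f hf] : forall y, exists p : X * Y, W y -> [/\ G p, nm p.1 <= C * nm y,
     nm (y - p.2) <= nm y / 2 & W (y - p.2)].
  move=> y; have [/H[x [y' h]]|nW] := pselect (W y); first by exists (x, y').
  by exists (0, 0).
pose r k := iter k (fun y => y - (f y).2) y0.
have Wr k : W (r k) by elim: k => [//|k IH]; have [_ _ _ h] := hf _ IH; exact: h.
have nr k : nm (r k) <= nm y0 * 2^-1 ^+ k.
  elim: k => [|k IH]; first by rewrite expr0 mulr1.
  have [_ _ h _] := hf _ (Wr k); apply: (le_trans h).
  by rewrite exprSr mulrA ler_wpM2r ?invr_ge0.
pose s k := \sum_(i < k) (f (r i)).1.
have sS k : s k.+1 = s k + (f (r k)).1 by rewrite /s big_ord_recr.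
have Gs k : G (s k, y0 - r k).
  elim: k => [|k IH]; first by rewrite /s big_ord0 subrr; exact: sG.1.
  have [h _ _ _] := hf _ (Wr k).
  have := is_subspaceD sG IH h; rewrite /s big_ord_recr /=.
  suff -> : (s k, y0 - r k) + f (r k) = (s k + (f (r k)).1,
     y0 - (r k - (f (r k)).2)) by [].
  by case: (f (r k)) => a b; congr pair => /=; lmod.
have ds k : nm (s k.+1 - s k) <= C * nm y0 * 2^-1 ^+ k.
  have [_ h _ _] := hf _ (Wr k).
  have -> : s k.+1 - s k = (f (r k)).1 by rewrite sS; lmod.
  apply: (le_trans h).
  by rewrite -mulrA ler_wpM2l.
have q01 : 0 <= (2^-1 : R) < 1 by lra.
have [l hl] := geom_cvg q01 ds; exists l; split; last first.
  have := hl 0%N; rewrite /s big_ord0 sub0r nmN expr0 mulr1.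
  suff -> : C * nm y0 / (1 - 2^-1) = 2 * C * nm y0 by [].
  by field.
apply: cG => e e0.
have [N1 h1] := expr_small (C * nm y0 / (1 - 2^-1)) q01 e0.
have [N2 h2] := expr_small (nm y0) q01 e0.
pose N := maxn N1 N2; exists (s N, y0 - r N); split; first exact: Gs.
have -> : (l, y0) - (s N, y0 - r N) = (l - s N, r N).
  by congr pair => /=; lmod.
rewrite nm_pair_lt nmBC (le_lt_trans (hl N))//=; last first.
  by rewrite mulrAC h1// leq_maxl.
by rewrite (le_lt_trans (nr N))// h2// leq_maxr.
Qed.

(** Baire by nested balls: if no [F n] is dense in any ball of [W], then each ball centred in [W]
    contains a smaller one, centred in [W] and missing [F n]; the limit of the centres escapes every
    [F n]. *)
Lemma baire_closed W (F : nat -> set Y) y0 : closed W -> W y0 ->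
  (forall y, W y -> exists n, F n y) ->
  exists n z (r : R), [/\ 0 < r, W z & forall y, W y -> nm (y - z) < r ->
    forall e : R, 0 < e -> exists b, F n b /\ nm (y - b) < e].
Proof.
move=> /closed_nmP cW Wy0 WF; apply: contrapT => H.
have step n (p : Y * R) : exists p' : Y * R, W p.1 /\ 0 < p.2 ->
    [/\ W p'.1, 0 < p'.2, p'.2 <= p.2 / 4, nm (p'.1 - p.1) <= p.2 / 2 &
    forall b, nm (b - p'.1) <= p'.2 -> ~ F n b].
  case: p => z r /=; have [[Wz r0]|] := pselect (W z /\ 0 < r); last by exists (0, 0).
  apply: contrapT => H'; apply: H; exists n, z, (r / 2); split => //; first lra.
  move=> y Wy yz e e0; apply: contrapT => nb; apply: H'.
  exists (y, Num.min (r / 4) (e / 2)) => _; split => //=.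
  - by rewrite lt_min; apply/andP; split; lra.
  - by rewrite ge_min lexx.
  - exact: ltW.
  - move=> b; rewrite le_min => /andP[_ hb] Fb; apply: nb; exists b.
    by split => //; rewrite nmBC; lra.
have /choice[g hg] : forall q : nat * (Y * R), exists p' : Y * R, W q.2.1 /\ 0 < q.2.2 ->
    [/\ W p'.1, 0 < p'.2, p'.2 <= q.2.2 / 4, nm (p'.1 - q.2.1) <= q.2.2 / 2 &
    forall b, nm (b - p'.1) <= p'.2 -> ~ F q.1 b].
  by case=> n p; exact: step.
pose u := fix u n := if n is n'.+1 then g (n', u n') else (y0, 1 : R).
have hu n : W (u n).1 /\ 0 < (u n).2.
  elim: n => [|n IH]; first by split; rewrite //= ltr01.
  by have [h1 h2 _ _ _] := hg (n, u n) IH; split; [exact: h1|exact: h2].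
have su n := hg (n, u n) (hu n).
have ru n : (u n).2 <= 1 * 4^-1 ^+ n.
  elim: n => [|n IH]; first by rewrite expr0 mulr1.
  have [_ _ h _ _] := su n; apply: (le_trans h) => /=.
  by rewrite exprSr mulrA ler_wpM2r ?invr_ge0.
have q01 : 0 <= (4^-1 : R) < 1 by lra.
have du k : nm ((u k.+1).1 - (u k).1) <= 2^-1 * 4^-1 ^+ k.
  have [_ _ _ h _] := su k; apply: (le_trans h) => /=.
  by have := ru k; rewrite mul1r; lra.
have [l hl] := geom_cvg q01 du.
(* A centre moves by at most half the radius and the next radius is at most a quarter of it, so the
   balls are nested. *)
have mono k j : nm ((u (k + j)%N).1 - (u k).1) + (u (k + j)%N).2 <= (u k).2.
  elim: j => [|j IH]; first by rewrite addn0 subrr nm0 add0r.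
  rewrite addnS; have [_ h0 h1 h2 _] := su (k + j)%N.
  move: h0 h1 h2 => /= h0 h1 h2.
  have := nm_tri (g ((k + j)%N, u (k + j)%N)).1 (u (k + j)%N).1 (u k).1.
  by have := (hu (k + j)%N).2; lra.
have lu k : nm (l - (u k).1) <= (u k).2.
  rewrite leNgt; apply/negP => hk.
  have [|N hN] := expr_small (2^-1 / (1 - 4^-1)) q01
    (e := nm (l - (u k).1) - (u k).2); first lra.
  have := hl (k + N)%N; have := hN _ (leq_addl k N); have := mono k N.
  have := nm_tri l (u (k + N)%N).1 (u k).1; have := (hu (k + N)%N).2.
  by rewrite (nmBC l (u (k + N)%N).1); lra.
have Wl : W l.
  apply: cW => e e0; have [N hN] := expr_small 1 q01 e0.
  exists (u N).1; split; first exact: (hu N).1.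
  by apply: (le_lt_trans (lu N)); apply: (le_lt_trans (ru N)); exact: hN.
have [n Fl] := WF l Wl; have [_ _ _ _ h] := su n.
exact: h l (lu n.+1) Fl.
Qed.

(** By Baire, the image of some ball is dense near a point of the range; differences move this to
    the origin, and [approx_solve] turns approximate solutions into exact ones. *)
Lemma open_mapping G : is_subspace G -> closed G -> closed (rng G) ->
  exists C : R, 0 < C /\
    forall y, rng G y -> exists x, G (x, y) /\ nm x <= C * nm y.
Proof.
move=> sG cG cW.
pose F n : set Y := [set y | exists x, G (x, y) /\ nm x <= n%:R]%classic.
have [n [z [r [r0 Wz hz]]]] : exists n z (r : R), [/\ 0 < r, rng G z &
    forall y, rng G y -> nm (y - z) < r ->
    forall e : R, 0 < e -> exists b, F n b /\ nm (y - b) < e].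
  apply: (@baire_closed (rng G) F 0) => // [|y [x Gx]].
    by exists 0; exact: sG.1.
  exists (Num.bound (nm x)), x; split => //; apply: ltW.
  by apply: archi_boundP; exact: nm_ge0.
have sW := is_subspace_rng sG.
have small y (e : R) : rng G y -> nm y < r -> 0 < e ->
    exists x y', [/\ G (x, y'), nm x <= 2 * n%:R & nm (y - y') < e].
  move=> Wy yr e0; have e2 : 0 < e / 2 by lra.
  have [|b1 [[x1 [G1 n1]] h1]] := hz (y + z) (is_subspaceD sW Wy Wz) _ _ e2.
    by rewrite addrK.
  have [|b2 [[x2 [G2 n2]] h2]] := hz z Wz _ _ e2; first by rewrite subrr nm0.
  exists (x1 - x2), (b1 - b2); split; first exact: (is_subspaceB sG G1 G2).
    by have := nmB x1 x2; lra.
  have -> : y - (b1 - b2) = (y + z - b1) - (z - b2) by lmod.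
  by have := nmB (y + z - b1) (z - b2); lra.
(* A nonzero [y] is rescaled to norm [r / 2], where approximate solutions have norm at most
   [2 * n]. *)
pose C := 4 * n%:R / r.
have C0 : 0 <= C by rewrite divr_ge0 ?mulr_ge0// ltW.
have : forall y, rng G y -> exists x y', [/\ G (x, y'), nm x <= C * nm y,
     nm (y - y') <= nm y / 2 & rng G (y - y')].
  move=> y Wy; have [->|y0] := eqVneq y 0.
    by exists 0, 0; rewrite subrr !nm0 mulr0 mul0r; split => //; try exists 0; exact: sG.1.
  have ny := nm_gt0 y0.
  pose c : R := r / (2 * nm y).
  have c0 : 0 < c by rewrite divr_gt0// mulr_gt0.
  have nc : nm c%:C = c by rewrite nm_real// ltW.
  have cn0 : c%:C != 0 :> R[i].
    by apply/eqP => h; move: nc; rewrite h nm0 => ?; lra.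
  have e0 : 0 < c * nm y / 2 by rewrite divr_gt0// mulr_gt0.
  have [||x [y' [Gx nx hy]]] := small (c%:C *: y) _ _ _ e0.
  - exact: is_subspaceZ.
  - rewrite nmZ nc; have -> : c * nm y = r / 2 by rewrite /c; field; rewrite gt_eqF.
    by lra.
  exists (c%:C^-1 *: x), (c%:C^-1 *: y'); split.
  - exact: (is_subspaceZ c%:C^-1 sG Gx).
  - rewrite nmZ nmV nc ler_pdivrMl//; apply: (le_trans nx).
    suff -> : c * (C * nm y) = 2 * n%:R by [].
    by rewrite /c /C; field; rewrite !gt_eqF.
  - have -> : y - c%:C^-1 *: y' = c%:C^-1 *: (c%:C *: y - y').
      by rewrite scalerBr scalerA mulVf// scale1r.
    by rewrite nmZ nmV nc ler_pdivrMl// mulrA ltW.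
  - apply: is_subspaceB => //; apply: is_subspaceZ => //; by exists x.
(* The added 1 makes the constant positive even if [n = 0]. *)
move=> /(approx_solve sG cG C0) H; exists (2 * C + 1); split; first lra.
move=> y /H[x [Gx nx]]; exists x; split => //; apply: (le_trans nx).
by rewrite ler_wpM2r ?nm_ge0//; lra.
Qed.

End OpenMapping.

(** * Ranges of finite codimension are closed *)

Section ClosedRange.
Context {R : realType} {X Y : completeNormedModType R[i]}.
Implicit Types (G : set (X * Y)).

(* Induction on the length of [s]: adjoining [(0, e)] to [G] keeps it closed and
   adds [e] to the range; if [e] is new, then the open mapping estimate for the
   enlarged relation controls the coefficient of [e]. *)
Lemma closed_rng G s : is_subspace G -> closed G ->
  (forall y, mspan (rng G) s y) -> closed (rng G).
Proof.
elim: s G => [|e s IH] G sG cG H.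
  by apply/closed_nmP => z _; exact: H.
pose G1 : set (X * Y) := [set z | exists c, G (z - c *: (0, e))]%classic.
have G1E x y : G1 (x, y) <-> exists c, G (x, y - c *: e).
  have E c : (x, y) - c *: (0, e) = (x, y - c *: e).
    by congr pair => /=; rewrite scaler0 subr0.
  by split=> -[c h]; exists c; move: h; rewrite /= E.
have sG1 : is_subspace G1.
  split=> [|a z z' [c h] [d h']]; first by exists 0; rewrite scale0r subr0; exact: sG.1.
  exists (a * c + d); have := sG.2 a _ _ h h'.
  by rewrite scalerBr addrACA -opprD scalerA -scalerDl.
have cG1 : closed G1 := closed_add_line sG cG.
have rngE y : rng G1 y <-> exists c, rng G (y - c *: e).
  by split=> [[x /G1E[c h]]|[c [x h]]]; [exists c, x|exists x; apply/G1E; exists c].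
have cr1 : closed (rng G1).
  apply: IH => // y; apply: mspanS (mspan_cons (H y)) => z /= h.
  by apply/rngE.
have sr := is_subspace_rng sG.
have [Ge|nGe] := pselect (rng G e).
  suff <- : rng G1 = rng G by [].
  apply/seteqP; split=> y; last by move=> [x h]; exists x; apply/G1E; exists 0; rewrite scale0r subr0.
  move=> /rngE[c h]; rewrite -(subrK (c *: e) y); apply: is_subspaceD => //.
  exact: is_subspaceZ.
have [C [C0 hC]] := open_mapping sG1 cG1 cr1.
apply/closed_nmP => z hz.
have rz : rng G1 z.
  move/closed_nmP : cr1; apply => d /hz[y [[x Gx] zy]]; exists y; split => //.
  by apply/rngE; exists 0; rewrite scale0r subr0; exists x.
have /rngE[c Gc] := rz.
have [c0|c0] := eqVneq c 0; first by move: Gc; rewrite c0 scale0r subr0.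
(* For [y] in [rng G] close to [z], the difference [y - z] has a small lift in [G1]; these lifts
   exhibit [(0, c *: e)] as a limit of points of [G]. *)
exfalso; apply: (nGe); suff G0 : G (0, c *: e).
  exists 0; rewrite -[e](scalerK c0).
  suff <- : c^-1 *: ((0 : X), c *: e) = (0, c^-1 *: (c *: e)).
    exact: is_subspaceZ.
  by congr pair; rewrite /= scaler0.
move/closed_nmP : cG; apply => d d0.
have C1 : 0 < C + 1 by lra.
have [y [Gy zy]] := hz (d / (C + 1)) ltac:(by rewrite divr_gt0).
have r1 : rng G1 (y - z).
  apply: is_subspaceB => //; first exact: is_subspace_rng.
  by apply/rngE; exists 0; rewrite scale0r subr0.
have [x [/G1E[b Gb] nx]] := hC _ r1.
(* Modulo [rng G], [y - z] is [- c *: e], and the coefficient of [e] is unique because [e] is not in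
   [rng G]. *)
have cb : b = - c.
  apply/eqP; rewrite -addr_eq0; apply/negPn/negP => bc; case: nGe.
  have hy : rng G (y - z - b *: e) by exists x.
  have : rng G ((b + c) *: e).
    have -> : (b + c) *: e = y - (y - z - b *: e) - (z - c *: e) by lmod.
    by apply: is_subspaceB => //; apply: is_subspaceB.
  by move=> /(is_subspaceZ (b + c)^-1 sr); rewrite scalerK.
exists (x, y - z + c *: e); split; first by move: Gb; rewrite cb scaleNr opprK.
have -> : ((0 : X), c *: e) - (x, y - z + c *: e) = (- x, z - y).
  by congr pair => /=; lmod.
have dC : 0 < d / (C + 1) by rewrite divr_gt0.
have dE : d / (C + 1) * (C + 1) = d by rewrite divfK// gt_eqF.
rewrite nm_pair_lt nmN; rewrite nmBC in nx.
apply/andP; split.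
  apply: (le_lt_trans nx); apply: (@le_lt_trans _ _ (C * (d / (C + 1)))).
    by rewrite ler_wpM2l ?ltW.
  by rewrite -[ltRHS]dE mulrC ltr_pM2l//; lra.
by apply: (lt_le_trans zy); rewrite -[leRHS]dE ler_peMr ?ltW//; lra.
Qed.

End ClosedRange.

(** * Bounded operators: lifts, closed images, inverses *)

Section BoundedMaps.
Context {R : realType} {X : completeNormedModType R[i]}.
Implicit Types (S T H : {linear X -> X}) (D : set X).

Definition bounded T := exists C : R, 0 < C /\ forall x, nm (T x) <= C * nm x.

Lemma bounded_opP T : bounded_op T <-> bounded T.
Proof.
rewrite /bounded_op linear_boundedP; split.
  move=> [M [Mr hM]]; have M1 : 0 < `|M| + 1 by rewrite ltr_wpDl.
  have /gt0_complex[ME M0] := M1.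
  exists (complex.Re (`|M| + 1)); split => // x; rewrite -lecR rmorphM /= -ME -!nmE.
  by apply: hM; rewrite ltr_pwDr// real_ler_norm.
move=> [C [C0 hC]]; exists C%:C; split; first by apply: gtr0_real; rewrite ltcR.
move=> M CM x; apply: (@le_trans _ _ (C%:C * `|x|)).
  by rewrite !nmE -rmorphM lecR.
by rewrite ler_wpM2r// ltW.
Qed.

Lemma mk_linear (f : X -> X) : linear f -> exists T : {linear X -> X}, forall x, T x = f x.
Proof.
move=> lf; pose F := GRing.isLinear.Build _ _ _ _ f lf.
by exists (HB.pack f F : {linear X -> X}).
Qed.

Lemma bounded_comp S T : bounded S -> bounded T -> bounded (S \o T).
Proof.
move=> [C [C0 hC]] [D [D0 hD]]; exists (C * D); split=> [|x /=]; first exact: mulr_gt0.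
by apply: (le_trans (hC _)); rewrite -mulrA ler_wpM2l// ltW.
Qed.

Lemma bounded_add S T : bounded S -> bounded T -> bounded (S \+ T).
Proof.
move=> [C [C0 hC]] [D [D0 hD]]; exists (C + D); split=> [|x /=]; first lra.
by rewrite mulrDl (le_trans (nmD _ _))// lerD.
Qed.

Lemma bounded_scale (a : R[i]) T : bounded T -> bounded (a \*: T).
Proof.
move=> [C [C0 hC]]; exists ((nm a + 1) * C); have a0 := nm_ge0 a.
split=> [|x /=]; first by apply: mulr_gt0 => //; lra.
rewrite nmZ -mulrA; apply: ler_pM => //; rewrite ?nm_ge0//; lra.
Qed.

Lemma bounded_id : bounded idfun.
Proof. by exists 1; split => // x; rewrite mul1r. Qed.

Definition graph_on D T : set (X * X) := [set p | D p.1 /\ p.2 = T p.1]%classic.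

Lemma is_subspace_graph D T : is_subspace D -> is_subspace (graph_on D T).
Proof.
move=> [D0 sD]; split=> [|a [x y] [x' y']]; first by split => //=; rewrite linear0.
by move=> [/= Dx ->] [/= Dx' ->]; split; [exact: sD|rewrite /= linearP].
Qed.

Lemma closed_graph_on D T : closed D -> bounded T -> closed (graph_on D T).
Proof.
move=> /closed_nmP cD [C [C0 hC]]; apply/closed_nmP => -[x y] h; split=> /=.
  apply: cD => e /h[[x' y'] [[/= Dx _]]]; rewrite nm_pair_lt => /andP[hx _].
  by exists x'.
apply/eqP; rewrite -subr_eq0; apply/eqP/nm_small0 => e e0.
have C1 : 0 < C + 1 by lra.
have d0 : 0 < e / (C + 1) by rewrite divr_gt0.
have dE : e / (C + 1) * (C + 1) = e by rewrite divfK// gt_eqF.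
have [[x' y'] [[/= _ ->]]] := h _ d0; rewrite nm_pair_lt => /andP[hx hy].
have -> : y - T x = (y - T x') - (T x - T x') by lmod.
rewrite -linearB; apply: (le_trans (nmB _ _)); have := hC (x - x').
set d := e / (C + 1) in hx hy d0 dE *.
have : C * nm (x - x') <= C * d by rewrite ler_wpM2l ?ltW.
by lra.
Qed.

Lemma rng_graph D T : rng (graph_on D T) = (T @` D)%classic.
Proof.
by apply/seteqP; split=> y [x]; [case=> /= Dx ->|move=> Dx <-]; exists x.
Qed.

Lemma is_subspace_image D T : is_subspace D -> is_subspace (T @` D)%classic.
Proof. by rewrite -rng_graph => /(is_subspace_graph T)/is_subspace_rng. Qed.

(** [T] may have a kernel in [D], so the bound concerns a well chosen preimage [x'] and not [x]
    itself. *)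
Lemma lift_bound T D : bounded T -> is_subspace D -> closed D ->
  closed (T @` D)%classic -> exists C : R, 0 < C /\
  forall x, D x -> exists x', [/\ D x', T x' = T x & nm x' <= C * nm (T x)].
Proof.
move=> bT sD cD; rewrite -rng_graph => cr.
have [C [C0 hC]] := open_mapping (is_subspace_graph T sD) (closed_graph_on cD bT) cr.
exists C; split => // x Dx; have [|x' [[/= Dx' h] nx]] := hC (T x).
  by exists x; split.
by exists x'; split.
Qed.

Lemma closed_image T D s : bounded T -> is_subspace D -> closed D ->
  (forall x, mspan (T @` D)%classic s x) -> closed (T @` D)%classic.
Proof.
move=> bT sD cD; rewrite -rng_graph.
exact: closed_rng (is_subspace_graph T sD) (closed_graph_on cD bT).
Qed.

Lemma approx_surj T D (C : R) : bounded T -> is_subspace D -> closed D -> 0 <= C ->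
  (forall x, D x -> D (T x)) ->
  (forall y, D y -> exists x, [/\ D x, nm x <= C * nm y & nm (y - T x) <= nm y / 2]) ->
  forall y, D y -> exists x, [/\ D x, T x = y & nm x <= 2 * C * nm y].
Proof.
move=> bT sD cD C0 TD H y Dy.
have [|x [[/= Dx ->] nx]] := @approx_solve _ _ _ _ D C (is_subspace_graph T sD)
   (closed_graph_on cD bT) C0 _ y Dy; last by exists x.
move=> z Dz; have [x [Dx nx h]] := H z Dz; exists x, (T x); split => //.
by apply: is_subspaceB => //; exact: TD.
Qed.

Lemma is_subspaceT : is_subspace [set: X]%classic.
Proof. by []. Qed.

Lemma closedT_nm : closed [set: X]%classic.
Proof. by apply/closed_nmP. Qed.

Lemma bounded_inverse T : bounded T -> bijective T ->
  exists H, [/\ cancel T H, cancel H T & bounded H].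
Proof.
move=> bT [f Tf fT]; have [|H HE] := mk_linear (f := f).
  by move=> a x y; apply: (can_inj Tf); rewrite linearP !fT.
have imT : (T @` setT)%classic = [set: X]%classic.
  by apply/seteqP; split=> // y _; exists (f y).
have [|C [C0 hC]] := lift_bound bT is_subspaceT closedT_nm.
  by rewrite imT; exact: closedT_nm.
exists H; split=> [x|x|]; rewrite ?HE//.
exists C; split => // y; have [x' [_ h n]] := hC (f y) I.
by rewrite HE -(can_inj Tf h); move: n; rewrite fT.
Qed.

(** Plays the role of the Neumann series: [y] itself solves [T x = y] up to the residual [- E y], of
    at most half the norm. *)
Lemma small_bijective T (E : {linear X -> X}) : bounded E ->
  (forall x, nm (E x) <= nm x / 2) -> (forall x, T x = x + E x) -> bijective T.
Proof.
move=> bE hE TE; have bT : bounded T.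
  by have [C [C0 hC]] := bounded_add bounded_id bE; exists C; split=> // x; rewrite TE hC.
have inj : injective T.
  move=> x y xy; apply/eqP; rewrite -subr_eq0; apply/eqP/nm_eq0.
  have h0 : T (x - y) = 0 by rewrite linearB xy subrr.
  have := hE (x - y); have := nmN (E (x - y)); rewrite TE in h0.
  have -> : - E (x - y) = x - y by apply/eqP; rewrite eq_sym -addr_eq0 h0.
  by have := nm_ge0 (x - y); lra.
have surj y : exists x, T x = y.
  have [||z _|x [_ ? _]] := @approx_surj T setT 1 bT is_subspaceT closedT_nm _ _ _ y I => //.
  - exists z; rewrite mul1r TE; split => //.
    by rewrite opprD addNKr nmN hE.
  - by exists x.
have /choice[f hf] := surj; exists f => // x; exact: inj.
Qed.

End BoundedMaps.

(** * Reduction to bounded operators *)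

Section Everywhere.
Context {R : realType} {X : completeNormedModType R[i]}.
Implicit Types (A L : linop X) (S T : {linear X -> X}).

Lemma mspanI (U V : set X) t x : is_subspace U ->
  (forall i, (i < size t)%N -> U (nth 0 t i)) -> U x -> mspan V t x ->
  mspan [set z | U z /\ V z]%classic t x.
Proof.
move=> sU; elim: t x => [|e t IH] x //= tU Ux [c h]; exists c; apply: IH => //.
  by move=> i; exact: (tU i.+1).
by apply: is_subspaceB => //; apply: is_subspaceZ => //; exact: (tU 0%N).
Qed.

Lemma mspan_map (D V W : set X) (f : X -> X) s x : is_subspace D ->
  (forall a y z, D y -> D z -> f (a *: y + z) = a *: f y + f z) ->
  (forall z, D z -> V z -> W (f z)) ->
  (forall i, (i < size s)%N -> D (nth 0 s i)) -> D x -> mspan V s x ->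
  mspan W (map f s) (f x).
Proof.
move=> sD lf VW; elim: s x => [|e s IH] x /= sI Dx; first exact: VW.
have De : D e := sI 0%N isT.
move=> [c h]; exists c; have <- : f (x - c *: e) = f x - c *: f e.
  by rewrite addrC -scaleNr lf// addrC scaleNr.
apply: IH => //; first by move=> i; exact: (sI i.+1).
by apply: is_subspaceB => //; exact: is_subspaceZ.
Qed.

Lemma linop0 A : A 0 = 0.
Proof.
have := @opfunP _ _ A 1 _ _ (@dom0 _ _ A) (@dom0 _ _ A).
by rewrite !scale1r addr0 => /eqP; rewrite -subr_eq0 opprD addNKr oppr_eq0 => /eqP.
Qed.

Section DomainPowers.
Variables (A : linop X) (l : R[i]).

Let E n := dom_pow A n.

Lemma is_subspace_dom : is_subspace (dom A).
Proof. by split=> [|a x y]; [exact: dom0|exact: domP]. Qed.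

Lemma dom_powS n x : E n.+1 x <-> dom A x /\ E n (A x).
Proof.
split=> [h|[Dx h] [//|k] kn].
  by split=> [|k kn]; [exact: (h 0%N)|rewrite -iterSr; exact: (h k.+1)].
by rewrite iterSr; exact: h.
Qed.

Lemma dom_pow_le m n x : (m <= n)%N -> E n x -> E m x.
Proof. by move=> mn h k km; apply: h; exact: leq_trans km mn. Qed.

Lemma is_subspace_dom_pow n : is_subspace (E n).
Proof.
elim: n => [|n IH]; first by split.
split=> [|a x y]; first by apply/dom_powS; split; [exact: dom0|rewrite linop0; exact: IH.1].
move=> /dom_powS[Dx Ex] /dom_powS[Dy Ey]; apply/dom_powS; split; first exact: domP.
by rewrite opfunP//; exact: IH.2.
Qed.

(** The converse climbs through the powers: once [x] is in [D(A^i)] with [i <= n], so is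
    [A x = (A x - l *: x) + l *: x], hence [x] is in [D(A^(i+1))]. *)
Lemma dom_pow_shift n x : E n.+1 x <-> dom A x /\ E n (A x - l *: x).
Proof.
have sE := is_subspace_dom_pow; split.
  move=> h; have /dom_powS[Dx Ex] := h; split => //.
  apply: (is_subspaceB (sE n)) => //; apply: (is_subspaceZ l (sE n)).
  exact: dom_pow_le h.
move=> [Dx h].
have: forall i, (i <= n.+1)%N -> E i x.
  elim=> [//|i IH] ni; apply/dom_powS; split => //.
  rewrite -(subrK (l *: x) (A x)); apply: (is_subspaceD (sE i)).
    exact: dom_pow_le h.
  by apply: (is_subspaceZ l (sE i)); apply: IH; exact: ltnW.
exact.
Qed.

(* The shifted operator maps [D(A^(j+2))] into [D(A^(j+1))], and its range meets
   [D(A^j)] in the image of [D(A^(j+1))]: if [D(A^(j+2))] has finite codimension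
   in [D(A^(j+1))], then so has [D(A^(j+1))] in [D(A^j)]. *)
Lemma finite_codim_dom N : finite_codim (op_range (op_shift A l)) ->
  dom_pow A N.+1 = dom_pow A N -> finite_codim (dom A).
Proof.
move=> /finite_codimP[r hr] EN; have sE := is_subspace_dom_pow.
have sR : is_subspace (op_range (op_shift A l)).
  split=> [|a _ _ [x Dx <-] [y Dy <-]]; first by exists 0; [exact: dom0|
    exact: linop0].
  by exists (a *: x + y); [exact: domP|exact: (@opfunP _ _ (op_shift A l))].
have step j : (exists s, forall x, E j.+1 x -> mspan (E j.+2) s x) ->
    exists s, forall x, E j x -> mspan (E j.+1) s x.
  move=> [s hs].
  have [s' [s'E hs']] := mspan_refine (sE j.+1) (sE j.+2) hs.
  have [t [tE ht]] := mspan_refine (sE j) sR (fun x _ => hr x).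
  exists (t ++ map (op_shift A l) s') => x Ex; apply/mspan_cat.
  (* Removing the [t] component leaves some [w = (A - l) y] in [D(A^j)]; then [y] is in
     [D(A^(j+1))], and its expansion over [s'] is pushed forward. *)
  apply: mspanS (mspanI (sE j) tE Ex (ht x Ex)) => w [+ [y Dy yw]].
  rewrite -yw => Ey; have E1 : E j.+1 y by apply/dom_pow_shift.
  apply: (mspan_map (D := dom A)) (hs' y E1) => //.
  - exact: is_subspace_dom.
  - by move=> a u v Du Dv; exact: (@opfunP _ _ (op_shift A l)).
  - by move=> z Dz /dom_pow_shift[].
  - by move=> i /s'E /dom_powS[].
have {step} down j : (exists s, forall x, E j x -> mspan (E j.+1) s x) ->
    exists s, forall x, E 0%N x -> mspan (E 1%N) s x.
  by elim: j => // j IH /step.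
have [|s hs] := down N; first by exists [::] => x; rewrite /E /= EN.
apply/finite_codimP; exists s => x; apply: mspanS (hs x _) => // y.
by move=> /dom_powS[].
Qed.

End DomainPowers.

Lemma closed_op_swap A : closed_op A ->
  closed [set p : X * X | dom A p.2 /\ p.1 = A p.2]%classic.
Proof.
move=> /closed_nmP cA; apply/closed_nmP => -[y x] h.
apply: (cA (x, y)) => e /h[[y' x'] [Gx]]; rewrite nm_pair_lt andbC => yx.
by exists (x', y'); split => //; rewrite nm_pair_lt.
Qed.

Lemma hatC_everywhere A : hatC A ->
  exists T, [/\ bounded T, forall x, dom A x & forall x, A x = T x].
Proof.
move=> [cA dA [l /contrapT[_ _ fc]] [N hN]].
have fD := finite_codim_dom fc (hN N (leqnn N)).
pose G : set (X * X) := [set p | dom A p.2 /\ p.1 = A p.2]%classic.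
have cG : closed G := closed_op_swap cA.
have sG : is_subspace G.
  split=> [|a [x y] [x' y']]; first by split; [exact: dom0|rewrite /= linop0].
  by move=> [/= Dy ->] [/= Dy' ->]; split; [exact: domP|rewrite /= opfunP].
have GE : rng G = dom A.
  by apply/seteqP; split=> y; [case=> x []|move=> Dy; exists (A y)].
have cD : closed (dom A).
  have /finite_codimP[s hs] := fD.
  by rewrite -GE; apply: (closed_rng sG cG (s := s)) => y; rewrite GE.
have D x : dom A x.
  move/closed_nmP : cD; apply => e e0.
  have [||y [By Dy]] := dA (ball x e%:C).
  - by exists x; apply: ballxx; rewrite ltcR.
  - by apply: ball_open; rewrite ltcR.
  by exists y; split=> //; move: By; rewrite -ball_normE /= nmE ltcR.
have [|T TE] := mk_linear (f := A); first by move=> a x y; exact: opfunP.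
(* The open mapping estimate for the inverted graph is the closed graph theorem. *)
exists T; split => //; have [|C [C0 hC]] := open_mapping sG cG; first by rewrite GE.
exists C; split => // x; have [|y [[_ /= yA] ny]] := hC x; first by rewrite GE.
by rewrite TE -yA.
Qed.

(** For bounded [S], [fredholm_everywhere] recovers the closed range from finite codimension through
    [closed_image]. *)
Definition fredholmT S :=
  finite_codim (range S) /\ finite_dim [set x | S x = 0]%classic.
Definition browderT S := [/\ fredholmT S,
  exists n, forall x, iter n.+1 S x = 0 -> iter n S x = 0 &
  exists n, forall x, exists y, iter n.+1 S y = iter n S x].

Lemma fredholm_everywhere L S : (forall x, dom L x) -> (forall x, L x = S x) ->
  bounded S -> fredholm L <-> fredholmT S.
Proof.
move=> D LS bS.
have RE : op_range L = range S.
  by apply/seteqP; split=> y [x _ <-]; exists x => //; rewrite ?LS.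
have NE : op_null L = [set x | S x = 0]%classic.
  by apply/seteqP; split=> x /=; rewrite /op_null /= LS; [case|split].
rewrite /fredholm /fredholmT RE NE; split=> [[]//|[fc fd]]; split => //.
have /finite_codimP[s hs] := fc.
exact: (closed_image bS is_subspaceT closedT_nm hs).
Qed.

Lemma browder_everywhere L S : (forall x, dom L x) -> (forall x, L x = S x) ->
  bounded S -> browder L <-> browderT S.
Proof.
move=> D LS bS.
have DE n : dom_pow L n = [set: X]%classic.
  by apply/seteqP; split=> // x _ k _; exact: D.
have iE n x : iter n L x = iter n S x by exact: eq_iter.
have NE n : null_pow L n = [set x | iter n S x = 0]%classic.
  by apply/seteqP; split=> x; rewrite /null_pow DE /= iE => // -[].
have RE n : range_pow L n = range (iter n S).
  by apply/seteqP; split=> y; rewrite /range_pow DE => -[x _ <-];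
    exists x => //; rewrite iE.
have FE := fredholm_everywhere D LS bS; split.
  move=> [/FE ? [n hn] [m hm]]; split => //.
    exists n => x; have : null_pow L n.+1 x -> null_pow L n x by rewrite -hn.
    by rewrite !NE.
  exists m => x; have : range_pow L m (iter m S x) by rewrite RE; exists x.
  by rewrite hm RE => -[y _ h]; exists y.
move=> [/FE ? [n hn] [m hm]]; split => //; [exists n|exists m].
  rewrite !NE; apply/seteqP; split=> x /=; last exact: hn.
  by move=> ->; rewrite linear0.
rewrite !RE; apply/seteqP; split=> _ [x _ <-].
  by have [y <-] := hm x; exists y.
by exists (S x) => //; rewrite -iterSr.
Qed.

End Everywhere.

(** * Browder operators *)

Section Browder.
Context {R : realType} {X : completeNormedModType R[i]}.
Implicit Types (S T : {linear X -> X}) (m : R[i]).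

Definition opshift T m : {linear X -> X} := T \- m \*: idfun.

Lemma opshiftE T m x : opshift T m x = T x - m *: x.
Proof. by []. Qed.

Lemma bounded_opshift T m : bounded T -> bounded (opshift T m).
Proof.
move=> bT; have [C [C0 hC]] := bounded_add bT (bounded_scale (- m) bounded_id).
by exists C; split => // x; have := hC x; rewrite /= scaleNr.
Qed.

Lemma inj_surj_bijective T : (forall x, T x = 0 -> x = 0) ->
  (forall y, exists x, T x = y) -> bijective T.
Proof.
move=> inj /choice[f hf]; exists f => // x.
by apply/eqP; rewrite -subr_eq0; apply/eqP/inj; rewrite linearB hf subrr.
Qed.

Lemma is_subspace_ker T : is_subspace [set x | T x = 0]%classic.
Proof.
by split=> [|a x y /= hx hy] /=; rewrite ?linear0// linearP hx hy scaler0 addr0.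
Qed.

Lemma iter_linear S n : exists T, (forall x, T x = iter n S x) /\
  (bounded S -> bounded T).
Proof.
elim: n => [|n [T [TE bT]]]; first by exists idfun; split=> // _; exact: bounded_id.
exists (S \o T); split=> [x|bS]; first by rewrite /= TE.
by apply: bounded_comp => //; exact: bT.
Qed.

Lemma range_iterE S n T : (forall x, T x = iter n S x) ->
  (T @` setT)%classic = range (iter n S).
Proof. by move=> TE; apply/seteqP; split=> y [x _ <-]; exists x. Qed.

Lemma is_subspace_range_iter S n : is_subspace (range (iter n S)).
Proof.
have [T [TE _]] := iter_linear S n.
by rewrite -(range_iterE TE); apply: is_subspace_image.
Qed.

Lemma codim_range_iter S n : finite_codim (range S) ->
  exists s, forall x, mspan (range (iter n S)) s x.
Proof.
move=> /finite_codimP[s hs]; elim: n => [|n [t ht]].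
  by exists [::] => x /=; exists x.
exists (t ++ map (iter n S) s) => x; apply/mspan_cat; apply: mspanS (ht x).
move=> _ [z _ <-]; have [T [TE _]] := iter_linear S n.
apply: (mspan_map (D := [set: X]%classic)) (hs z) => // [a u v _ _|_ _ [w _ <-]].
  by rewrite -!TE linearP.
by exists w => //; rewrite iterSr.
Qed.

Lemma closed_range_iter S n : bounded S -> finite_codim (range S) ->
  closed (range (iter n S)).
Proof.
move=> bS fc; have [s hs] := codim_range_iter n fc.
have [T [TE bT]] := iter_linear S n; rewrite -(range_iterE TE).
by apply: (closed_image (bT bS) is_subspaceT closedT_nm (s := s)) => x; rewrite (range_iterE TE).
Qed.

Lemma range_iter_le S n k x : (n <= k)%N -> range (iter k S) x -> range (iter n S) x.
Proof.
move=> nk [y _ <-]; exists (iter (k - n) S y) => //.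
by rewrite -iterD subnKC.
Qed.

Lemma range_iter_S S n x : range (iter n S) x -> range (iter n S) (S x).
Proof. by move=> [y _ <-]; exists (S y) => //; rewrite -iterSr. Qed.

(** A bounded lift [x] of [y] through [S] solves the shifted equation up to [m *: x], whose norm is
    at most half that of [y]. *)
Lemma shift_surj S (D : set X) (C : R) m : bounded S -> is_subspace D -> closed D ->
  0 <= C -> (forall x, D x -> D (S x)) ->
  (forall y, D y -> exists x, [/\ D x, S x = y & nm x <= C * nm y]) ->
  nm m * C <= 1 / 2 ->
  forall y, D y -> exists x, [/\ D x, S x - m *: x = y & nm x <= 2 * C * nm y].
Proof.
move=> bS sD cD C0 SD H mC y Dy.
apply: (approx_surj (bounded_opshift m bS) sD cD C0) Dy => [x Dx|z Dz].
  by apply: (is_subspaceB sD); [exact: SD|exact: is_subspaceZ].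
have [x [Dx Sx nx]] := H z Dz; exists x; split => //.
have -> : z - opshift S m x = m *: x by rewrite opshiftE Sx; lmod.
rewrite nmZ; apply: (@le_trans _ _ (nm m * (C * nm z))).
  by rewrite ler_wpM2l ?nm_ge0.
by rewrite mulrA; have := ler_wpM2r (nm_ge0 z) mC; lra.
Qed.

(* On the generalized range [R_oo] the operator is onto, hence so are its small
   shifts, with uniformly bounded lifts; the injective ones then force
   [N(S)] to meet [R_oo] trivially. *)
Lemma browder_limit S : bounded S -> fredholmT S ->
  (forall e : R, 0 < e -> exists m, nm m < e /\ bijective (opshift S m)) -> browderT S.
Proof.
move=> bS [fc fd] lim; have sr := is_subspace_range_iter S.
have cr n := closed_range_iter (n := n) bS fc.
have s0 : is_subspace [set (0 : X)]%classic.
  by split=> //= a x y -> ->; rewrite scaler0 addr0.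
have sN := is_subspace_ker S.
have /finite_dimP[s [_ hs]] := fd.
have [n|n x [Sx rx]|x [/hs]//|p hp] := chain_stationary
    (U := fun n => [set x | S x = 0 /\ range (iter n S) x]%classic) (s := s).
- exact: is_subspaceI.
- by split => //; exact: range_iter_le rx.
pose D : set X := [set x | forall n, range (iter n S) x]%classic.
have sD : is_subspace D.
  by split=> [n|a x y Dx Dy n]; [exact: (sr n).1|exact: (sr n).2].
have cD : closed D.
  apply/closed_nmP => z h n; have /closed_nmP := cr n; apply => e /h[y [Dy zy]].
  by exists y.
have SD x : D x -> D (S x) by move=> Dx n; exact: range_iter_S.
have ND w : S w = 0 -> range (iter p S) w -> D w.
  move=> Sw rw n; have [pn|/ltnW np] := leqP p n; first by have [] := hp n w pn.
  exact: range_iter_le rw.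
(* Two preimages of [y], one in [R(S^p)] and one in [R(S^n)] with [n > p], differ by an element of
   [N(S)] in [R(S^p)], hence in [R(S^n)] by the choice of [p]. *)
have DS y : D y -> exists2 x, D x & S x = y.
  move=> Dy; have [x _ xy] := Dy p.+1.
  exists (iter p S x) => // n.
  have [pn|/ltnW np] := leqP p n; last by apply: (@range_iter_le _ _ p) => //; exists x.
  have [z _ zy] := Dy n.+1.
  have rx : range (iter p S) (iter p S x) by exists x.
  have rz : range (iter p S) (iter n S z).
    by apply: (@range_iter_le _ _ n) => //; exists z.
  rewrite -(subrK (iter n S z) (iter p S x)); apply: (is_subspaceD (sr n)); last by exists z.
  have [] // := hp n (iter p S x - iter n S z) pn; split; last exact: (is_subspaceB (sr p)).
  by rewrite linearB; move: xy zy => /= -> ->; rewrite subrr.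
have [C [C0 hC]] : exists C : R, 0 < C /\ forall y, D y -> exists x,
    [/\ D x, S x = y & nm x <= C * nm y].
  have imD : (S @` D)%classic = D.
    by apply/seteqP; split=> [_ [x Dx <-]|y /DS[x Dx <-]]; [exact: SD|exists x].
  have [|C [C0 hC]] := lift_bound bS sD cD; first by rewrite imD.
  exists C; split => // y /DS[x Dx <-]; have [x' [Dx' h nx]] := hC x Dx.
  by exists x'.
have small (c : R) : 0 < c -> exists m, nm m * c <= 1 / 4 /\ bijective (opshift S m).
  move=> c0; have [|m [me bm]] := lim (1 / (4 * c)).
    by rewrite divr_gt0// mulr_gt0.
  exists m; split => //; apply: (@le_trans _ _ (1 / (4 * c) * c)).
    by rewrite ler_wpM2r ?ltW.
  by rewrite le_eqVlt; apply/orP; left; apply/eqP; field; rewrite gt_eqF.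
(* If [S x = 0] then [x] solves [(S - m) x' = - m *: x]. The bounded solution in [D] is the same one
   by injectivity, so its norm is at most half of itself. *)
have inj x : D x -> S x = 0 -> x = 0.
  move=> Dx Sx; have [m [mC bm]] := small C C0.
  have mC' : nm m * C <= 1 / 2 by lra.
  have [x' [Dx' Sx' nx]] :=
    shift_surj bS sD cD (ltW C0) SD hC mC' (is_subspaceZ (- m) sD Dx).
  have xx : x' = x.
    by apply: (bij_inj bm); rewrite !opshiftE Sx' Sx sub0r scaleNr.
  apply: nm_eq0; move: nx; rewrite xx nmZ nmN.
  by have := ler_wpM2r (nm_ge0 x) mC; have := nm_ge0 x; lra.
have asc x : iter p.+1 S x = 0 -> iter p S x = 0.
  by move=> h; apply: inj => //; apply: ND => //; exists x.
split => //; first by exists p.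
pose V := range (iter p S).
have injV x : V x -> S x = 0 -> x = 0.
  by move=> Vx Sx; apply: inj => //; exact: ND.
have [|K [K0 hK]] := lift_bound bS (sr p) (cr p).
  suff -> : (S @` range (iter p S))%classic = range (iter p.+1 S) by [].
  by apply/seteqP; split=> [_ [_ [x _ <-] <-]|_ [x _ <-]];
    [exists x|exists (iter p S x) => //; exists x].
have low x : V x -> nm x <= K * nm (S x).
  move=> Vx; have [x' [Vx' h nx]] := hK x Vx.
  suff <- : x' = x by rewrite h.
  apply/eqP; rewrite -subr_eq0; apply/eqP/injV; first exact: (is_subspaceB (sr p)).
  by rewrite linearB h subrr.
have [m [mK bm]] := small K K0.
(* For [z = S^p u], applying [S^p] to [(S - m)^-1 u] gives an approximate solution of [S x = z] in
   [V] with residual [- m *: x]; the lower bound [low] and [nm m * K <= 1 / 4] give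
   [nm x <= 2 * K * nm z]. *)
have surV y : V y -> exists x, [/\ V x, S x = y & nm x <= 2 * (2 * K) * nm y].
  apply: (approx_surj bS (sr p) (cr p)); first by lra.
    by move=> x; exact: range_iter_S.
  move=> z [u _ uz]; have [g _ gK] := bm.
  have [T [TE _]] := iter_linear S p.
  exists (T (g u)).
  have Vx : V (T (g u)) by exists (g u).
  have Sx : S (T (g u)) = z + m *: T (g u).
    rewrite -uz -TE -{2}[u]gK opshiftE linearB linearZ /= subrK.
    by rewrite !TE -iterS iterSr.
  have := low _ Vx; rewrite Sx => h1.
  have h2 := nmD z (m *: T (g u)); rewrite nmZ in h2.
  have h3 := ler_wpM2r (nm_ge0 (T (g u))) mK.
  have h4 := ler_wpM2l (ltW K0) h2.
  have h5 := nm_ge0 (T (g u)); have h6 := nm_ge0 m; have h7 := nm_ge0 z.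
  have h8 : nm (T (g u)) <= 2 * K * nm z.
    have h8 : 0 <= K * nm z by rewrite mulr_ge0 ?(ltW K0).
    by clear -h1 h3 h4 h5 h8; lra.
  split => //.
  have -> : z - (z + m *: T (g u)) = - (m *: T (g u)) by lmod.
  rewrite nmN nmZ; have h9 := ler_wpM2l h6 h8; have h10 := ler_wpM2r h7 mK.
  by clear -h9 h10; lra.
exists p => x; have [|_ [[z _ <-] h _]] := surV (iter p S x); first by exists x.
by exists z.
Qed.

(** A finite Neumann series: a solution [z] for [S n0] yields the solution [m^-1 *: (z - n0)] for
    [n0]. *)
Lemma nilpotent_shift S k m n0 : m != 0 -> iter k S n0 = 0 ->
  exists z, S z - m *: z = n0.
Proof.
move=> m0; elim: k n0 => [|k IH] n0; first by move=> /= ->; exists 0; rewrite linear0 scaler0 subr0.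
rewrite iterSr => /IH[z hz]; exists (m^-1 *: (z - n0)).
have E : S z - S n0 = m *: z by rewrite -hz; lmod.
by rewrite linearZ linearB /= E !scalerA mulVf// mulfV// !scale1r; lmod.
Qed.

(** The larger of the ascent and descent exponents makes [S] bijective on [R(S^k)], which is closed;
    open mapping then bounds its inverse there. *)
Lemma browder_split S : bounded S -> browderT S -> exists k (C : R),
  [/\ closed (range (iter k S)), 0 < C,
    forall y, range (iter k S) y -> exists2 x, range (iter k S) x & S x = y &
    forall x, range (iter k S) x -> nm x <= C * nm (S x)].
Proof.
move=> bS [[fc fd] [p hp] [q hq]].
pose k := maxn p q.
have asc x : iter k.+1 S x = 0 -> iter k S x = 0.
  by rewrite /k -(subnKC (leq_maxl p q)) -addSn !iterD; exact: hp.
have desc x : exists y, iter k.+1 S y = iter k S x.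
  rewrite /k -(subnK (leq_maxr p q)); have [y hy] := hq x.
  by exists y; rewrite -addnS !iterD hy.
have sr := is_subspace_range_iter S k; have cr := closed_range_iter (n := k) bS fc.
pose V := range (iter k S).
have surV y : V y -> exists2 x, V x & S x = y.
  move=> [x _ <-]; have [z hz] := desc x.
  by exists (iter k S z) => //; exists z.
have injV x : V x -> S x = 0 -> x = 0 by move=> [z _ <-]; exact: asc.
have SV x : V x -> V (S x) by exact: range_iter_S.
have imV : (S @` V)%classic = V.
  by apply/seteqP; split=> [_ [x Vx <-]|y /surV[x Vx <-]]; [exact: SV|exists x].
have [|C [C0 hC]] := lift_bound bS sr cr; first by rewrite imV.
have low x : V x -> nm x <= C * nm (S x).
  move=> Vx; have [x' [Vx' h nx]] := hC x Vx.
  suff <- : x' = x by rewrite h.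
  apply/eqP; rewrite -subr_eq0; apply/eqP/injV; first exact: (is_subspaceB sr).
  by rewrite linearB h subrr.
by exists k, C.
Qed.

(* [X] is the direct sum of [R(S^k)], where [S] is invertible, and [N(S^k)], where
   it is nilpotent. *)
Lemma browder_punctured S : bounded S -> browderT S ->
  exists d : R, 0 < d /\ forall m, 0 < nm m < d -> bijective (opshift S m).
Proof.
move=> bS /(browder_split bS)[k [C [cr C0 surV low]]].
have sr := is_subspace_range_iter S k.
pose V := range (iter k S).
have SV x : V x -> V (S x) by exact: range_iter_S.
exists (1 / (2 * C)); split; first by rewrite divr_gt0// mulr_gt0.
move=> m /andP[m0 mC'].
have mC : nm m * C <= 1 / 2.
  apply: (@le_trans _ _ (1 / (2 * C) * C)); first by rewrite ler_wpM2r ?ltW.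
  by rewrite le_eqVlt; apply/orP; left; apply/eqP; field; rewrite gt_eqF.
have mn0 : m != 0 by apply/eqP => h; move: m0; rewrite h nm0 ltxx.
have iterV j y : V y -> exists2 v, V v & iter j S v = y.
  elim: j y => [|j IH] y Vy; first by exists y.
  have [v Vv hv] := surV y Vy; have [w Vw hw] := IH v Vv.
  by exists w => //=; rewrite hw.
apply: inj_surj_bijective => [x|y].
  (* An eigenvector for [m] is [m^-k *: S^k x], hence lies in [V], where [low] forbids so small an
     eigenvalue. *)
  rewrite opshiftE => /eqP; rewrite subr_eq0 => /eqP Sx.
  have it j : iter j S x = m ^+ j *: x.
    elim: j => [|j /= ->]; first by rewrite expr0 scale1r.
    by rewrite linearZ /= Sx scalerA -exprSr.
  have Vx : V x.
    have -> : x = (m ^+ k)^-1 *: iter k S x.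
      by rewrite it scalerA mulVf ?scale1r// expf_neq0.
    by apply: (is_subspaceZ _ sr); exists x.
  apply: nm_eq0; have := low x Vx; rewrite Sx nmZ.
  by have := ler_wpM2r (nm_ge0 x) mC; have := nm_ge0 x; lra.
(* [v] is the component of [y] in [R(S^k)], and [y - v] is in [N(S^k)]; the equation is solved on
   each separately. *)
have [v Vv hv] := iterV k (iter k S y) ltac:(by exists y).
have [|z hz] := @nilpotent_shift S k m (y - v) mn0.
  by have [T [TE _]] := iter_linear S k; rewrite -TE linearB !TE hv subrr.
have [u Vu|w [_ hw _]] := shift_surj bS sr cr (ltW C0) SV _ mC Vv.
  have [x Vx Sx] := surV u Vu; exists x; split => //.
  by rewrite -Sx low.
exists (w + z); rewrite linearD !opshiftE hw hz; lmod.
Qed.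

End Browder.

(** * Riesz operators *)

Section Riesz.
Context {R : realType} {X : completeNormedModType R[i]}.
Implicit Types (A B S T U V W : {linear X -> X}) (a b l : R[i]).

(** Spares explicit inverses: below, [V] is an approximate inverse commuting with [U], and [W] a
    perturbation of the identity, up to a scalar. *)
Lemma bijective_comm U V W : (forall x, U (V x) = W x) ->
  (forall x, V (U x) = W x) -> bijective W -> bijective U.
Proof.
move=> UV VU [g gK Kg]; apply: inj_surj_bijective => [x Ux|y].
  have := gK x; rewrite -VU Ux linear0 => <-.
  by have := gK 0; rewrite linear0.
by exists (V (g y)); rewrite UV.
Qed.

Lemma bijective_shift_large T (C : R) a : (forall x, nm (T x) <= C * nm x) ->
  bounded T -> 0 < C -> 2 * C <= nm a -> bijective (opshift T a).
Proof.
move=> hC bT C0 Ca; have na : 0 < nm a by lra.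
have a0 : a != 0 by apply/eqP => h; move: na; rewrite h nm0 ltxx.
have aT : bijective (idfun \+ ((- a^-1) \*: T) : {linear X -> X}).
  apply: (small_bijective (bounded_scale (- a^-1) bT)) => // x.
  rewrite /= nmZ nmN nmV ler_pdivrMl//; apply: (le_trans (hC x)).
  by have := ler_wpM2r (nm_ge0 x) Ca; lra.
have sa : bijective ((- a) \*: idfun : {linear X -> X}).
  exists (fun x => (- a)^-1 *: x) => x /=;
  by rewrite scalerA ?mulVf ?mulfV ?oppr_eq0// scale1r.
apply: (@eq_bij _ _ _ (bij_comp sa aT)) => x.
by rewrite /= scalerDr scalerA mulrNN mulfV// scale1r scaleNr addrC.
Qed.

(** Membership of [a] in the closure of the resolvent set of [T]. *)
Definition near_resolvent T a := forall e : R, 0 < e ->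
  exists b, nm (b - a) < e /\ bijective (opshift T b).

Lemma browder_near_resolvent T a : bounded T -> fredholmT (opshift T a) ->
  near_resolvent T a -> browderT (opshift T a).
Proof.
move=> bT fT ra; apply: browder_limit => [||e /ra[b [ba bb]]] //.
  exact: bounded_opshift.
exists (b - a); split => //; apply: (eq_bij bb) => x.
by rewrite !opshiftE; lmod.
Qed.

Lemma browder_resolvent_disc T a : bounded T -> browderT (opshift T a) ->
  exists d : R, 0 < d /\ forall b, 0 < nm (b - a) < d -> bijective (opshift T b).
Proof.
move=> bT /(browder_punctured (bounded_opshift a bT))[d [d0 h]].
exists d; split => // b /h hb; apply: (eq_bij hb) => x.
by rewrite !opshiftE; lmod.
Qed.

Lemma browder_near T a : bounded T -> browderT (opshift T a) -> near_resolvent T a.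
Proof.
move=> bT /(browder_resolvent_disc bT)[d [d0 h]] e e0.
pose c := Num.min (d / 2) (e / 2).
have c0 : 0 < c by rewrite lt_min; apply/andP; split; lra.
exists (a + c%:C); rewrite addrC addKr nm_real ?ltW//.
have cd : c <= d / 2 by rewrite ge_min lexx.
have ce : c <= e / 2 by rewrite ge_min lexx orbT.
split; first lra.
by apply: h; rewrite addrC addKr nm_real ?ltW// c0; lra.
Qed.

(* The set of parameters in question is open and closed in the ray from [a] to
   infinity, and contains its far end. *)
Lemma riesz_near_resolvent T a : bounded T ->
  (forall b, b != 0 -> fredholmT (opshift T b)) -> a != 0 -> near_resolvent T a.
Proof.
move=> bT fT a0; have na := nm_gt0 a0.
have nR (t : R) : nm t%:C = `|t| by rewrite /nm normc_def /= expr0n /= addr0 sqrtr_sqr.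
pose p (t : R) := t%:C * a.
have pB t s : nm (p t - p s) = `|t - s| * nm a.
  by rewrite /p -mulrBl -rmorphB nmM nR.
have open t : 1 <= t -> near_resolvent T (p t) ->
    exists d : R, 0 < d /\ forall s, `|s - t| < d -> near_resolvent T (p s).
  move=> t1 rt; have pt0 : p t != 0.
    by rewrite mulf_neq0// fmorph_eq0 gt_eqF//; lra.
  have [d [d0 h]] := browder_resolvent_disc bT (browder_near_resolvent bT (fT _ pt0) rt).
  exists (d / nm a); split=> [|s]; first exact: divr_gt0.
  rewrite ltr_pdivlMr// -pB => sd e e0.
  have [st|st] := eqVneq (p s) (p t); first by rewrite st; exact: rt.
  exists (p s); rewrite subrr nm0; split => //; apply: h.
  by rewrite sd nm_gt0// subr_eq0.
have closed t : (forall e : R, 0 < e -> exists s, `|s - t| < e /\ near_resolvent T (p s)) ->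
    near_resolvent T (p t).
  move=> h e e0; have [|s [st rs]] := h (e / (2 * nm a)).
    by rewrite divr_gt0// mulr_gt0.
  have [|b [bs bb]] := rs (e / 2); first lra.
  exists b; split => //; have := nm_tri b (p s) (p t).
  move: st; rewrite ltr_pdivlMr ?mulr_gt0// mulrCA -pB; lra.
have [C [C0 hC]] := bT.
pose M := 2 * C / nm a.
have far t : M <= t -> 1 <= t -> near_resolvent T (p t).
  move=> Mt t1 e e0; exists (p t); rewrite subrr nm0; split => //.
  apply: (bijective_shift_large hC) => //.
  by rewrite /p nmM nR ger0_norm ?(le_trans _ t1)// -ler_pdivrMr.
suff : near_resolvent T (p 1) by rewrite /p mul1r.
apply: contrapT => n1.
(* The bad parameters. Their supremum is good, being a limit of good ones from above; openness then
   makes the bad parameters just below it good. *)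
pose Z : set R := [set t | 1 <= t /\ ~ near_resolvent T (p t)]%classic.
have Z1 : Z 1 by [].
have hsZ : has_sup Z.
  split; first by exists 1.
  exists (Num.max M 1) => t [t1 nt]; rewrite leNgt; apply/negP => /ltW.
  by rewrite ge_max => /andP[Mt _]; exact: nt (far t Mt t1).
have s1 : 1 <= sup Z by apply: ub_le_sup => //; exact: hsZ.2.
have rs : near_resolvent T (p (sup Z)).
  apply: closed => e e0; exists (sup Z + e / 2).
  split; first by rewrite [X in `|X|](_ : _ = e / 2) ?ger0_norm; lra.
  apply: contrapT => n; have : sup Z + e / 2 <= sup Z.
    by apply: ub_le_sup; [exact: hsZ.2|split => //; lra].
  by lra.
have [d [d0 hd]] := open _ s1 rs.
have [t Zt st] := sup_adherent d0 hsZ; have [_ nt] := Zt; apply: nt; apply: hd.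
have : t <= sup Z by apply: ub_le_sup => //; exact: hsZ.2.
by move=> ts; rewrite distrC ger0_norm; lra.
Qed.

(* With [E = A B] idempotent, [A - l] factors as [(A (1 - E) - l) (1 - A E / l)],
   and the second factor is invertible for small [l] since its product with
   [1 - E - l B] is [1 - l B]. *)
Lemma drazin_factor A B T l : (forall x, B (A x) = A (B x)) ->
  (forall x, B (A (B x)) = B x) -> (forall x, T x = A (x - A (B x))) -> l != 0 ->
  bijective (idfun \- l \*: B : {linear X -> X}) ->
  exists U, [/\ bijective U, forall x, opshift T l (U x) = opshift A l x &
    forall x, U (opshift T l x) = opshift A l x].
Proof.
move=> BA BAB TE l0 bl; pose U : {linear X -> X} := idfun \- l^-1 \*: (A \o A \o B).
have ABB x : A (B (B x)) = B x by rewrite -BA BAB.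
have UE x : U x = x - l^-1 *: A (A (B x)) by [].
exists U; split=> [|x|x].
- pose V : {linear X -> X} := (idfun \- (A \o B)) \- l \*: B.
  have VE x : V x = x - A (B x) - l *: B x by [].
  apply: (@bijective_comm U V (idfun \- l \*: B)) => // x; rewrite [RHS]/=.
  + rewrite UE VE !linearB !linearZ /= !BA !ABB; lmod.
  + by rewrite VE UE !linearB !linearZ /= !BA !ABB; lmod.
- by rewrite !opshiftE !TE UE !linearB !linearZ /= ?BA ?ABB ?linearB ?linearZ /=; lmod.
- by rewrite UE !opshiftE !TE !linearB !linearZ /= !BA !ABB; lmod.
Qed.

(** A commuting bijective factor changes neither the range nor the kernel. *)
Lemma fredholm_factor S T U : bijective U -> (forall x, T (U x) = S x) ->
  (forall x, U (T x) = S x) -> fredholmT T -> fredholmT S.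
Proof.
move=> [g gK Kg] TU UT [fc fd].
have rE : range S = range T.
  apply/seteqP; split=> y [x _ <-]; first by exists (U x); rewrite // TU.
  by exists (g x); rewrite // -TU Kg.
suff nE : [set x | S x = 0]%classic = [set x | T x = 0]%classic by rewrite /fredholmT rE nE.
apply/seteqP; split=> y /=; rewrite -UT; last by move=> ->; rewrite linear0.
move=> Uy; have := gK (T y); rewrite Uy => <-.
by have := gK 0; rewrite linear0.
Qed.

Lemma sigma_e_riesz T l : riesz T -> l != 0 -> fredholmT (opshift T l).
Proof.
move=> [/bounded_opP bT sT] l0.
have /(fredholm_everywhere (L := op_shift (op_of_linear T) l)) := bounded_opshift l bT.
move=> H; apply/H => //; apply: contrapT => n.
have : sigma_e (op_of_linear T) l by [].
by rewrite sT /= => /eqP; rewrite (negPf l0).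
Qed.

Lemma drazin_browder A B T : bounded A -> bounded B ->
  (forall x, B (A x) = A (B x)) -> (forall x, B (A (B x)) = B x) ->
  (forall x, T x = A (x - A (B x))) -> riesz T ->
  exists d : R, 0 < d /\ forall l, 0 < nm l < d -> browderT (opshift A l).
Proof.
move=> bA [C [C0 hC]] BA BAB TE rT; have /bounded_opP bT := rT.1.
pose d := 1 / (2 * C); have d0 : 0 < d by rewrite divr_gt0// mulr_gt0.
have fac l : 0 < nm l < d -> exists U, [/\ bijective U,
    forall x, opshift T l (U x) = opshift A l x & forall x, U (opshift T l x) = opshift A l x].
  move=> /andP[l0 ld]; apply: (drazin_factor BA BAB TE).
    by apply/eqP => h; move: l0; rewrite h nm0 ltxx.
  have bB : bounded B by exists C.
  apply: (small_bijective (bounded_scale (- l) bB)) => [x|x] /=; last by rewrite scaleNr.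
  rewrite nmZ nmN; apply: (@le_trans _ _ (nm l * (C * nm x))).
    by rewrite ler_wpM2l ?nm_ge0.
  have lC : nm l * C <= 1 / 2.
    apply: (@le_trans _ _ (d * C)); first by rewrite ler_wpM2r ?ltW.
    by rewrite le_eqVlt; apply/orP; left; apply/eqP; rewrite /d; field; rewrite gt_eqF.
  by have := ler_wpM2r (nm_ge0 x) lC; lra.
exists d; split => // l ld; have l0 : l != 0.
  by apply/eqP => h; move: ld; rewrite h nm0 ltxx.
have fT b : b != 0 -> fredholmT (opshift T b) by exact: sigma_e_riesz.
apply: browder_near_resolvent => //.
  by have [U [bU TU UT]] := fac l ld; exact: fredholm_factor bU TU UT (fT l l0).
move=> e e0; have /andP[l1 l2] := ld.
(* The last two bounds keep [b] in the punctured disc, where the factorisation holds too. *)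
have [|b [be bb]] := riesz_near_resolvent bT fT l0
    (e := Num.min e (Num.min (nm l) (d - nm l))).
  by rewrite !lt_min e0 l1 subr_gt0.
move: be; rewrite !lt_min => /and3P[be b1 b2]; exists b; split => //.
have bd : 0 < nm b < d.
  have := nm_sub b l; have := nm_sub l b; rewrite (nmBC l b) => *.
  by apply/andP; split; lra.
have [U [bU TU _]] := fac b bd.
exact: (eq_bij (bij_comp bb bU)).
Qed.

End Riesz.

(** * Spectral projection of a circle *)

Section RootsOfMinusOne.
Context {R : realType}.
Implicit Types z : R[i].

Lemma nm_sqr z : nm z ^+ 2 = complex.Re z ^+ 2 + complex.Im z ^+ 2.
Proof. by rewrite /nm normc_def /= sqr_sqrtr// addr_ge0 ?sqr_ge0. Qed.

(** By the parallelogram identity, one of the two square roots has [nm (s + 1) ^+ 2 >= 2], so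
    [nm (s + 1) >= 4 / 3]; and [z - 1 = (s - 1) * (s + 1)]. *)
Lemma sqrt_near1 z : nm z = 1 -> exists s, [/\ s ^+ 2 = z, nm s = 1 &
  nm (s - 1) <= 3 / 4 * nm (z - 1)].
Proof.
move=> z1; pose s0 := sqrtC z.
have s0z : s0 ^+ 2 = z by exact: sqrtCK.
have n0 s : s ^+ 2 = z -> nm s = 1.
  move=> sz; have := nmX s 2; rewrite sz z1 => /esym/eqP.
  by rewrite sqrf_eq1 => /orP[/eqP//|/eqP h]; have := nm_ge0 s; rewrite h; lra.
have key s : s ^+ 2 = z -> 2 <= nm (s + 1) ^+ 2 -> exists s, [/\ s ^+ 2 = z, nm s = 1 &
  nm (s - 1) <= 3 / 4 * nm (z - 1)].
  move=> sz h; exists s; split => //; first exact: n0.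
  have -> : z - 1 = (s - 1) * (s + 1) by rewrite -sz; ring.
  rewrite nmM; have s1 := nm_ge0 (s + 1).
  have : 4 / 3 <= nm (s + 1).
    rewrite leNgt; apply/negP => lt; have : nm (s + 1) ^+ 2 < 2; last lra.
    by rewrite expr2; nra.
  by have := nm_ge0 (s - 1); nra.
have par : nm (s0 + 1) ^+ 2 + nm (- s0 + 1) ^+ 2 = 4.
  have := n0 _ s0z; move/(congr1 (fun t => t ^+ 2)); rewrite !nm_sqr expr1n.
  by case: (s0) => a b /=; lra.
have [h|h] := leP 2 (nm (s0 + 1) ^+ 2); first exact: key h.
by apply: (key (- s0)); [rewrite sqrrN|lra].
Qed.

(** Successive square roots of -1, each taken on the side of 1. The roots of unity of order
    [2^(k+1)] are those of order [2^k] and their multiples by [eta k]. *)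
Lemma dyadic_roots : exists eta : nat -> R[i], forall k,
  [/\ eta k ^+ (2 ^ k)%N = -1, nm (eta k) = 1 &
      nm (eta k - 1) <= 2 * (3 / 4) ^+ k].
Proof.
have /choice[s hs] : forall z, exists s, nm z = 1 -> [/\ s ^+ 2 = z, nm s = 1 &
  nm (s - 1) <= 3 / 4 * nm (z - 1)].
  move=> z; have [/sqrt_near1[s hs]|n] := pselect (nm z = 1); first by exists s.
  by exists 0.
exists (fun k => iter k s (-1)); elim=> [|k [h1 h2 h3]].
  rewrite expn0 expr1 /= nmN nm1; split => //.
  by rewrite -opprD nmN expr0 mulr1 (le_trans (nmD _ _))// nm1; lra.
have [g1 g2 g3] := hs _ h2; split => //=.
  by rewrite expnS exprM g1.
by rewrite exprS; lra.
Qed.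

End RootsOfMinusOne.

(** * Averaged resolvents near the unit circle *)

Section SpectralProjection.
Context {R : realType} {X : completeNormedModType R[i]}.
Implicit Types (z l : R[i]).
Variables (A : {linear X -> X}) (CA : R).
Hypotheses (CA0 : 0 < CA) (hCA : forall x, nm (A x) <= CA * nm x).
Hypothesis circle : forall z, nm z = 1 -> bijective (idfun \- z \*: A : {linear X -> X}).

Let bA : bounded A. Proof. by exists CA. Qed.

Lemma bounded_one_sub z : bounded (idfun \- z \*: A : {linear X -> X}).
Proof.
have [C [C0 hC]] := bounded_add bounded_id (bounded_scale (- z) bA).
by exists C; split => // x; have := hC x; rewrite /= scaleNr.
Qed.

Lemma one_sub_perturb z z' (c : R) : nm (z' - z) * (CA * c) <= 1 / 2 -> 0 < c ->
  (forall x, nm x <= c * nm (x - z *: A x)) ->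
  forall x, nm x <= 2 * c * nm (x - z' *: A x).
Proof.
move=> zc c0 h x; have h1 := h x; have h2 := hCA x.
have h3 : nm (x - z *: A x) <= nm (x - z' *: A x) + nm (z' - z) * nm (A x).
  rewrite -nmZ; have -> : x - z *: A x = (x - z' *: A x) + (z' - z) *: A x by lmod.
  exact: nmD.
have h4 : nm (z' - z) * nm (A x) * c <= 1 / 2 * nm x.
  apply: (@le_trans _ _ (nm (z' - z) * (CA * nm x) * c)).
    by rewrite ler_wpM2r ?(ltW c0)// ler_wpM2l ?nm_ge0.
  by have := ler_wpM2r (nm_ge0 x) zc; lra.
have h5 := ler_wpM2l (ltW c0) h3; lra.
Qed.

(** By compactness: parameters with worse and worse bounds would cluster at some [l] on the circle,
    where the bound [c] persists nearby as [2 * c]. *)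
Lemma circle_bound : exists C : R, 0 < C /\
  forall z, nm z = 1 -> forall x, nm x <= C * nm (x - z *: A x).
Proof.
apply: contrapT => n.
have /choice[z hz] : forall k : nat, exists z, nm z = 1 /\
    exists x, k.+1%:R * nm (x - z *: A x) < nm x.
  move=> k; apply: contrapT => h; apply: n; exists k.+1%:R; split=> [|z z1 x].
    by rewrite ltr0n.
  by rewrite leNgt; apply/negP => lt; apply: h; exists z; split => //; exists x.
have [k|l hl] := @bounded_cluster R z 1; first by rewrite (hz k).1.
have l1 : nm l = 1.
  have [//|e0] := eqVneq (nm l) 1.
  have : 0 < `|nm l - 1| by rewrite normr_gt0 subr_eq0.
  move=> /(hl _ 0%N)[k [_ h]]; have := nm_sub l (z k); have := nm_sub (z k) l.
  rewrite (nmBC l) (hz k).1; move: h => + h1 h2.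
  by rewrite ltNge => /negP; case; rewrite ler_norml; apply/andP; split; lra.
have [H [HK KH [c [c0 hc]]]] := bounded_inverse (bounded_one_sub l) (circle l1).
have hc' x : nm x <= c * nm (x - l *: A x).
  by have := hc (x - l *: A x); have -> : H (x - l *: A x) = x by exact: HK.
pose N := Num.bound (2 * c).
have e0 : 0 < 1 / (2 * (CA * c)) by rewrite divr_gt0// mulr_gt0// mulr_gt0.
have [k [Nk zk]] := hl _ N e0.
have [_ [x hx]] := hz k.
have zc : nm (z k - l) * (CA * c) <= 1 / 2.
  apply: (@le_trans _ _ (1 / (2 * (CA * c)) * (CA * c))).
    by rewrite ler_wpM2r ?(ltW zk)// mulr_ge0 ?ltW.
  by rewrite le_eqVlt; apply/orP; left; apply/eqP; field; rewrite !gt_eqF.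
have h1 := one_sub_perturb zc c0 hc' x.
have h2 : 2 * c <= k.+1%:R.
  apply: (@le_trans _ _ N%:R); last by rewrite ler_nat leqW.
  by apply/ltW/archi_boundP; lra.
by have := ler_wpM2r (nm_ge0 (x - z k *: A x)) h2; lra.
Qed.

(** Only the outer side is covered, because [spectral_projection] compares the unit circle with a
    slightly larger one. *)
Lemma annulus_bound : exists C d : R, [/\ 0 < C, 0 < d &
  forall z, 1 <= nm z <= 1 + d -> bijective (idfun \- z \*: A : {linear X -> X}) /\
    forall x, nm x <= C * nm (x - z *: A x)].
Proof.
have [C [C0 hC]] := circle_bound.
have CAC : 0 < CA * C by exact: mulr_gt0.
exists (2 * C), (1 / (2 * (CA * C))); split.
- by rewrite mulr_gt0.
- by rewrite divr_gt0// mulr_gt0.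
move=> z /andP[z1 zd]; have z0 : 0 < nm z by lra.
pose w := (nm z)%:C^-1 * z.
have nz : nm (nm z)%:C = nm z by rewrite nm_real// ltW.
have w1 : nm w = 1 by rewrite nmM nmV nz mulVf// gt_eqF.
have zw : nm (z - w) <= 1 / (2 * (CA * C)).
  have -> : z - w = ((nm z)%:C - 1) * w.
    by rewrite mulrBl mul1r /w mulrA mulfV ?mul1r// fmorph_eq0 gt_eqF.
  rewrite nmM w1 mulr1; have -> : (nm z)%:C - 1 = (nm z - 1)%:C by rewrite rmorphB.
  by rewrite nm_real ?subr_ge0// lerBlDl.
have zc : nm (z - w) * (CA * C) <= 1 / 2.
  apply: (@le_trans _ _ (1 / (2 * (CA * C)) * (CA * C))).
    by rewrite ler_wpM2r// ltW.
  by rewrite le_eqVlt; apply/orP; left; apply/eqP; field; rewrite !gt_eqF.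
split; last by apply: one_sub_perturb; [exact: zc|exact: C0|exact: hC].
have [H [HK KH bH]] := bounded_inverse (bounded_one_sub w) (circle w1).
have hH x : nm (H x) <= C * nm x.
  by have := hC w w1 (H x); have -> : H x - w *: A (H x) = x by exact: KH.
have E1 : bijective (idfun \+ ((w - z) \*: (H \o A)) : {linear X -> X}).
  apply: (small_bijective (bounded_scale (w - z) (bounded_comp bH bA))) => // x /=.
  rewrite nmZ nmBC; apply: (@le_trans _ _ (nm (z - w) * (C * (CA * nm x)))).
    rewrite ler_wpM2l ?nm_ge0//; apply: (le_trans (hH _)).
    by rewrite ler_wpM2l ?hCA// ltW.
  by have := ler_wpM2r (nm_ge0 x) zc; lra.
apply: (eq_bij (bij_comp (circle w1) E1)) => x /=.
have E2 y : H y - w *: A (H y) = y by exact: KH.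
have -> : A (x + (w - z) *: H (A x)) = A x + (w - z) *: A (H (A x)).
  by rewrite linearD linearZ.
rewrite -[X in _ - z *: X](E2 (A x)) -[X in w *: (X + _)](E2 (A x)).
by lmod.
Qed.

(* [F k z] is the average of the resolvents [(1 - u z A)^-1] over the [2^k]-th roots
   of unity [u], which equals [(1 - (z A)^(2^k))^-1]. *)
Lemma dyadic_resolvents : exists (C d L : R) (F : nat -> R[i] -> {linear X -> X}),
  [/\ 0 < C, 0 < d, 0 < L &
   forall k z, 1 <= nm z <= 1 + d ->
   [/\ forall x, nm (F k z x) <= C * nm x,
       forall z' x, 1 <= nm z' <= 1 + d ->
         nm (F k z x - F k z' x) <= L * nm (z - z') * nm x,
       forall x, F k z (A x) = A (F k z x),
       forall x, F k z x - z ^+ (2 ^ k)%N *: iter (2 ^ k)%N A (F k z x) = x &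
       nm z = 1 -> forall x, nm (F k.+1 z x - F k z x) <= L * nm x * (3 / 4) ^+ k]].
Proof.
have [eta heta] := @dyadic_roots R.
have [C [d [C0 d0 hC]]] := annulus_bound.
have /choice[H hH] : forall z, exists H : {linear X -> X}, 1 <= nm z <= 1 + d ->
    (forall x, H (x - z *: A x) = x) /\ (forall x, H x - z *: A (H x) = x).
  move=> z; have [/hC[bz _]|n] := pselect (1 <= nm z <= 1 + d); last by exists idfun.
  have [H [HK KH _]] := bounded_inverse (bounded_one_sub z) bz.
  by exists H => _; split=> x; [exact: HK|exact: KH].
pose L := C * (CA * C); have L0 : 0 < L by rewrite mulr_gt0// mulr_gt0.
pose F := fix F k z : {linear X -> X} := if k is k'.+1
  then 2%:R^-1 \*: (F k' z \+ F k' (eta k' * z)) else H z.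
have FS k z x : F k.+1 z x = 2%:R^-1 *: (F k z x + F k (eta k * z) x) by [].
have n2 : nm (2%:R^-1 : R[i]) = 2^-1.
  by rewrite nmV -[2%:R]/((2%:R : R[i])) -(rmorph_nat (real_complex R)) nm_real.
have annE k z : 1 <= nm z <= 1 + d -> 1 <= nm (eta k * z) <= 1 + d.
  by rewrite nmM; have [_ -> _] := heta k; rewrite mul1r.
have Fb k z x : 1 <= nm z <= 1 + d -> nm (F k z x) <= C * nm x.
  elim: k z => [|k IH] z hz.
    have [_ h] := hH z hz; have [_ hz'] := hC z hz.
    by have := hz' (H z x); rewrite h.
  rewrite FS nmZ n2; have := nmD (F k z x) (F k (eta k * z) x).
  by have := IH z hz; have := IH _ (annE k z hz); lra.
have FL k z z' x : 1 <= nm z <= 1 + d -> 1 <= nm z' <= 1 + d ->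
    nm (F k z x - F k z' x) <= L * nm (z - z') * nm x.
  elim: k z z' => [|k IH] z z' hz hz'.
    have [h1 h2] := hH z hz; have [h3 h4] := hH z' hz'.
    (* The resolvent identity; it explains the constant [L = C * (CA * C)]. *)
    have -> : F 0%N z x - F 0%N z' x = (z - z') *: H z (A (H z' x)).
      have E : H z (x - (H z' x - z *: A (H z' x))) = H z x - H z' x.
        by rewrite linearB h1.
      transitivity (H z ((z - z') *: A (H z' x))); last by rewrite linearZ.
      rewrite [LHS]/= -E; apply: (congr1 (H z)).
      by rewrite -{1}(h4 x); lmod.
    rewrite nmZ; apply: (@le_trans _ _ (nm (z - z') * (C * (CA * (C * nm x))))).
      rewrite ler_wpM2l ?nm_ge0//; apply: (le_trans (Fb 0%N z _ hz)).
      rewrite ler_wpM2l ?(ltW C0)//; apply: (le_trans (hCA _)).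
      by rewrite ler_wpM2l ?(ltW CA0)//; exact: (Fb 0%N z').
    by rewrite /L; lra.
  rewrite !FS -scalerBr nmZ n2.
  have -> : F k z x + F k (eta k * z) x - (F k z' x + F k (eta k * z') x) =
    (F k z x - F k z' x) + (F k (eta k * z) x - F k (eta k * z') x) by lmod.
  have := nmD (F k z x - F k z' x) (F k (eta k * z) x - F k (eta k * z') x).
  have := IH _ _ hz hz'; have := IH _ _ (annE k z hz) (annE k z' hz').
  by rewrite -mulrBr nmM; have [_ -> _] := heta k; rewrite mul1r; lra.
exists C, d, L, F; split => // k z hz; split=> [x|z' x hz'|x|x|z1 x].
- exact: Fb.
- exact: FL.
- elim: k z hz x => [|k IH] z hz x.
    have [h1 h2] := hH z hz; rewrite /= -{1}(h2 x) linearB linearZ /=.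
    exact: h1.
  by rewrite !FS (IH _ hz) (IH _ (annE k z hz)) -linearD linearZ.
- elim: k z hz x => [|k IH] z hz x.
    by have [h1 h2] := hH z hz; rewrite expn0 expr1 /= h2.
  have [T [TE _]] := iter_linear A (2 ^ k)%N.
  have h1 := IH _ hz x; have h2 := IH _ (annE k z hz) x.
  (* With [T = A^(2^k)] and [w = z^(2^k)], the value -1 of [eta k ^+ (2 ^ k)] turns the second
     equation into [(1 + w T) f' = x], while [(1 - w T) f = x]; the average of [f] and [f'] inverts
     [1 - w^2 T^2]. *)
  rewrite exprMn in h2; have [e1 _ _] := heta k; rewrite e1 mulN1r scaleNr opprK in h2.
  rewrite -TE in h1; rewrite -TE in h2.
  rewrite expnS mulnC exprM mulnC mul2n -addnn iterD -!TE FS.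
  set w := z ^+ _ in h1 h2 *; set f := F k z x in h1 h2 *.
  set f' := F k _ x in h1 h2 *.
  have g1 : w *: T (T f) = T f - T x by rewrite -[in T x]h1 linearB linearZ /=; lmod.
  have g2 : w *: T (T f') = T x - T f' by rewrite -[in T x]h2 linearD linearZ /=; lmod.
  have g3 : T (T (2%:R^-1 *: (f + f'))) = 2%:R^-1 *: (T (T f) + T (T f')).
    by rewrite linearZ linearD linearZ linearD.
  rewrite g3; have -> : 2%:R^-1 *: (f + f') - w ^+ 2 *: (2%:R^-1 *: (T (T f) + T (T f'))) =
    2%:R^-1 *: (f + f' - w *: (w *: T (T f) + w *: T (T f'))) by lmod.
  rewrite g1 g2; have -> : f + f' - w *: (T f - T x + (T x - T f')) =
    (f - w *: T f) + (f' + w *: T f') by lmod.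
  by rewrite h1 h2; lmod.
rewrite FS; have -> : 2%:R^-1 *: (F k z x + F k (eta k * z) x) - F k z x =
  2%:R^-1 *: (F k (eta k * z) x - F k z x) by lmod.
rewrite nmZ n2; have := FL k _ z x (annE k z hz) hz.
have -> : eta k * z - z = (eta k - 1) * z by rewrite mulrBl mul1r.
rewrite nmM z1 mulr1; have [_ _ h3] := heta k.
have : L * nm (eta k - 1) * nm x <= L * (2 * (3 / 4) ^+ k) * nm x.
  by rewrite ler_wpM2r ?nm_ge0// ler_wpM2l ?(ltW L0).
lra.
Qed.

End SpectralProjection.

(** * The limit of the averages is a projection *)

Section RieszSplitting.
Context {R : realType} {X : completeNormedModType R[i]}.
Implicit Types (A B P T : {linear X -> X}) (z l : R[i]).

Lemma spectral_projection A : bounded A ->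
  (forall z, nm z = 1 -> bijective (idfun \- z \*: A : {linear X -> X})) ->
  exists P (D : R) (F : nat -> {linear X -> X}),
  [/\ bounded P, 0 < D, forall x, P (P x) = P x, forall x, P (A x) = A (P x) &
  forall k, [/\ forall x, nm (F k x - P x) <= D * (3 / 4) ^+ k * nm x,
    forall x, F k (A x) = A (F k x) &
    forall x, F k x - iter (2 ^ k)%N A (F k x) = x]].
Proof.
move=> [CA [CA0 hCA]] circle.
have [C [d [L [F [C0 d0 L0 hF]]]]] := dyadic_resolvents CA0 hCA circle.
have q01 : 0 <= (3 / 4 : R) < 1 by lra.
have in1 : 1 <= nm (1 : R[i]) <= 1 + d by rewrite nm1; lra.
pose f k := F k 1.
have /choice[P0 hP0] : forall x, exists p, forall k,
    nm (f k x - p) <= L * nm x * (3 / 4) ^+ k / (1 - 3 / 4).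
  move=> x; apply: (geom_cvg q01) => k.
  by have [_ _ _ _ h] := hF k 1 in1; exact: h nm1 x.
pose D := L * 4; have D0 : 0 < D by rewrite mulr_gt0.
have hP k x : nm (f k x - P0 x) <= D * (3 / 4) ^+ k * nm x.
  apply: (le_trans (hP0 x k)); rewrite /D le_eqVlt; apply/orP; left; apply/eqP.
  by field.
have lim0 (y : X) (M : R) : (forall k, nm y <= M * (3 / 4) ^+ k) -> y = 0.
  move=> h; apply: nm_small0 => e e0; have [N hN] := expr_small M q01 e0.
  exact: le_trans (h N) (ltW (hN N (leqnn N))).
have fA k x : f k (A x) = A (f k x) by have [_ _ h _ _] := hF k 1 in1; exact: h.
have q0 k : 0 <= (3 / 4 : R) ^+ k by rewrite exprn_ge0//; lra.
have [|P PE] := mk_linear (f := P0).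
  move=> a x y; apply/eqP; rewrite -subr_eq0; apply/eqP.
  apply: (lim0 _ (D * nm (a *: x + y) + D * nm a * nm x + D * nm y)) => k.
  have -> : P0 (a *: x + y) - (a *: P0 x + P0 y) =
    - (f k (a *: x + y) - P0 (a *: x + y)) + (a *: (f k x - P0 x) + (f k y - P0 y)).
    by rewrite (linearP (f k)); lmod.
  apply: (le_trans (nmD _ _)); rewrite nmN.
  have := nmD (a *: (f k x - P0 x)) (f k y - P0 y); rewrite nmZ.
  have := hP k (a *: x + y); have := hP k y; have := ler_wpM2l (nm_ge0 a) (hP k x); lra.
have {}hP k x : nm (f k x - P x) <= D * (3 / 4) ^+ k * nm x by rewrite PE.
have bP x : nm (P x) <= (C + D) * nm x.
  have := hP 0%N x; rewrite expr0 mulr1 nmBC => h.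
  have [h1 _ _ _ _] := hF 0%N 1 in1; have := h1 x; have := nm_sub (P x) (f 0%N x).
  by rewrite -/(f 0%N x); lra.
exists P, D, f; split => // [|x|x|k]; first (by exists (C + D); split => //; lra); last first.
- split=> // x.
  by have [_ _ _ h _] := hF k 1 in1; have := h x; rewrite expr1n scale1r.
- apply/eqP; rewrite -subr_eq0; apply/eqP.
  apply: (lim0 _ (D * nm (A x) + CA * D * nm x)) => k.
  have -> : P (A x) - A (P x) = - (f k (A x) - P (A x)) + A (f k x - P x).
    by rewrite (linearB A) fA; lmod.
  apply: (le_trans (nmD _ _)); rewrite nmN.
  have := hP k (A x); have := hCA (f k x - P x).
  by have := ler_wpM2l (ltW CA0) (hP k x); lra.
(* Idempotence compares two radii. For [N = 2^k] and [y = x - f k x = - A^N (f k x)], the average at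
   radius [s > 1] sends [y] to a vector of size [s^-N], and it differs little from [f k y] when [s]
   is near 1. *)
suff : P (x - P x) = 0 by rewrite linearB => /eqP; rewrite subr_eq0 => /eqP.
apply: nm_small0 => e e0.
have C1 : 0 < (1 + C) by lra.
have nx := nm_ge0 x.
pose M := (1 + C) * nm x; have M0 : 0 <= M by rewrite mulr_ge0 ?(ltW C1).
(* [s] is fixed first, making the Lipschitz error at most [e / 2]; then [k] makes each of the two
   remaining errors at most [e / 4]. [M] bounds the norm of [y] for all [k]. *)
pose s := 1 + Num.min d (e / (2 * L * (M + 1))).
have e1 : 0 < e / (2 * L * (M + 1)).
  by rewrite divr_gt0// !mulr_gt0// ltr_wpDl.
have s1 : 1 < s by rewrite ltrDl lt_min d0.
have sd : s <= 1 + d by rewrite lerD2l ge_min lexx.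
have s0 : 0 < s := lt_trans ltr01 s1.
have ns : nm s%:C = s by rewrite nm_real ?ltW.
have ins : 1 <= nm s%:C <= 1 + d by rewrite ns sd ltW.
have sL : L * (s - 1) * M <= e / 2.
  have h1 : s - 1 <= e / (2 * L * (M + 1)) by rewrite /s addrC addKr ge_min lexx orbT.
  apply: (@le_trans _ _ (L * (e / (2 * L * (M + 1))) * (M + 1))).
    apply: ler_pM => //; last by rewrite lerDl.
      by rewrite mulr_ge0 ?(ltW L0)// subr_ge0 ltW.
    by rewrite ler_wpM2l ?(ltW L0).
  rewrite le_eqVlt; apply/orP; left; apply/eqP; field.
  by rewrite !gt_eqF// ltr_wpDl.
have q01' : 0 <= s^-1 < 1 by rewrite invr_ge0 (ltW s0) invf_lt1.
have e4 : 0 < e / 4 by rewrite divr_gt0.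
have [N1 h1] := expr_small ((C + D) * D * nm x + D * M) q01 e4.
have [N2 h2] := expr_small ((1 + C) * (C * nm x)) q01' e4.
pose k := maxn N1 N2.
have Nk1 := h1 k (leq_maxl _ _).
have Nk2 := h2 (2 ^ k)%N (leq_trans (leq_maxr N1 N2) (ltnW (@ltn_expl 2 k isT))).
have [F1 F2 F3 F4 _] := hF k 1 in1; have [G1 G2 G3 G4 _] := hF k s%:C ins.
pose y := x - f k x.
have ny : nm y <= M.
  have h3 := nmB x (f k x); have h4 : nm (f k x) <= C * nm x := F1 x.
  by rewrite /M; clear -h3 h4; lra.
have Gy : nm (F k s%:C y) <= (1 + C) * (C * nm x) * s^-1 ^+ (2 ^ k)%N.
  have [T [TE _]] := iter_linear A (2 ^ k)%N.
  have GT u : F k s%:C (T u) = T (F k s%:C u).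
    by rewrite !TE; elim: (2 ^ k)%N => //= n <-; rewrite G3.
  have yE : y = - T (f k x).
    by have := F4 x; rewrite expr1n scale1r -TE -/(f k x) /y => {1}<-; lmod.
  have := G4 (f k x); rewrite -TE -GT => E.
  have sn : s%:C ^+ (2 ^ k)%N != 0 by rewrite expf_neq0// fmorph_eq0 gt_eqF.
  have -> : F k s%:C y = (s%:C ^+ (2 ^ k)%N)^-1 *: (f k x - F k s%:C (f k x)).
    have E' : s%:C ^+ (2 ^ k)%N *: F k s%:C (T (f k x)) = F k s%:C (f k x) - f k x.
      by apply/eqP; rewrite eq_sym subr_eq addrC -subr_eq E.
    by rewrite yE linearN -[X in - X](scalerK sn) E'; lmod.
  rewrite nmZ nmV nmX ns exprVn mulrC ler_wpM2r ?invr_ge0 ?exprn_ge0 ?(ltW s0)//.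
  have a1 := nmB (f k x) (F k s%:C (f k x)); have a2 := G1 (f k x).
  have a3 : nm (f k x) <= C * nm x := F1 x; have a4 := ler_wpM2l (ltW C0) a3.
  by clear -a1 a2 a3 a4; lra.
have -> : x - P x = (x - f k x) + (f k x - P x) by lmod.
rewrite -/y linearD.
have -> : P y = - (f k y - P y) + ((F k 1 y - F k s%:C y) + F k s%:C y) by rewrite /f; lmod.
have a1 := hP k y; have a2 := F2 s%:C y ins; have a3 := bP (f k x - P x); have a4 := hP k x.
apply: (le_trans (nmD _ _)).
have b1 := nmD (- (f k y - P y)) ((F k 1 y - F k s%:C y) + F k s%:C y).
have b2 := nmD (F k 1 y - F k s%:C y) (F k s%:C y); rewrite nmN in b1.
have a5 : nm (F k 1 y - F k s%:C y) <= L * (s - 1) * M.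
  apply: (le_trans a2); have -> : nm (1 - s%:C) = s - 1.
    rewrite nmBC; have -> : s%:C - 1 = (s - 1)%:C by rewrite rmorphB.
    by rewrite nm_real// subr_ge0 ltW.
  by rewrite ler_wpM2l// mulr_ge0 ?(ltW L0)// subr_ge0 ltW.
have a6 : D * (3 / 4) ^+ k * nm y <= D * (3 / 4) ^+ k * M.
  by rewrite ler_wpM2l// mulr_ge0 ?(ltW D0).
have a7 : (C + D) * nm (f k x - P x) <= (C + D) * (D * (3 / 4) ^+ k * nm x).
  by rewrite ler_wpM2l// addr_ge0 ?ltW.
by clear -a1 a3 a4 a5 a6 a7 b1 b2 Gy Nk1 Nk2 sL; lra.
Qed.

End RieszSplitting.

(** * Splitting an operator along a free circle *)

Section RieszDecomposition.
Context {R : realType} {X : completeNormedModType R[i]}.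
Implicit Types (A B P T : {linear X -> X}) (z l : R[i]).

(** [T - l] divides [T^n - l^n]. *)
Lemma power_shift T l n x : exists y : X, iter n T x - l ^+ n *: x = T y - l *: y.
Proof.
elim: n => [|n [z hz]]; first by exists 0; rewrite linear0 scale1r scaler0 !subrr.
exists (iter n T x + l *: z).
have -> : T (iter n T x + l *: z) = T (iter n T x) + l *: T z by rewrite linearD linearZ.
have -> : l *: T z = l *: (iter n T x - l ^+ n *: x) + l *: (l *: z) by rewrite hz; lmod.
by rewrite iterS exprS; lmod.
Qed.

Lemma bijective_scale l : l != 0 -> bijective (l \*: idfun : {linear X -> X}).
Proof.
by move=> l0; exists (fun x => l^-1 *: x) => x /=; rewrite scalerA ?mulVf ?mulfV// scale1r.
Qed.

Lemma iter_compl A P T : (forall x, P (P x) = P x) -> (forall x, P (A x) = A (P x)) ->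
  (forall x, T x = A (P x)) -> forall n x, iter n.+1 T x = iter n.+1 A (P x).
Proof.
move=> PP PA TE; elim=> [|n IH] x; first exact: TE.
have PiA m y : P (iter m A y) = iter m A (P y) by elim: m => //= m <-; rewrite PA.
by rewrite [LHS]iterS IH TE PiA PP.
Qed.

(* Both bijectivity claims hold because [F k] approximates the identity on the range
   of [P] and zero on its kernel. *)
Lemma circle_drazin A : bounded A ->
  (forall z, nm z = 1 -> bijective (idfun \- z \*: A : {linear X -> X})) ->
  exists B T, [/\ bounded B, forall x, B (A x) = A (B x), forall x, B (A (B x)) = B x,
    forall x, T x = A (x - A (B x)) &
    forall l, 1 <= nm l -> bijective (opshift T l)].
Proof.
move=> bA circle; have [P [D [F [bP D0 PP PA hF]]]] := spectral_projection bA circle.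
have [CP [CP0 hCP]] := bP.
have q01 : 0 <= (3 / 4 : R) < 1 by lra.
have [k hk] : exists k, 2 * D * (1 + CP) * (3 / 4) ^+ k <= 1 / 2.
  have [|N hN] := expr_small (2 * D * (1 + CP)) q01 (e := 1 / 2); first lra.
  by exists N; exact/ltW/hN.
have [fP fA fT] := hF k; set f := F k in fP fA fT.
have q0 : 0 <= (3 / 4 : R) ^+ k by rewrite exprn_ge0//; lra.
have small : D * (3 / 4) ^+ k * (1 + CP) <= 1 / 4 by lra.
(* One factor of [A^(2^k)] is split off: [A^n (f y)], up to sign, is then an approximate preimage of
   [y] under [A] on the kernel of [P]. *)
have [n nE] : exists n, (2 ^ k = n.+1)%N by exists (2 ^ k).-1; rewrite prednK ?expn_gt0.
rewrite nE in fT.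
have [Tm [TmE bTm]] := iter_linear A n.
pose Tn := (A \o Tm : {linear X -> X}).
have TnE x : Tn x = iter n.+1 A x by rewrite /= TmE.
have {}fT x : f x - Tn (f x) = x by rewrite TnE fT.
have ATm x : Tm (A x) = A (Tm x) by rewrite !TmE -iterSr.
have PTm x : P (Tm x) = Tm (P x) by rewrite !TmE; elim: (n) => //= m <-; rewrite PA.
have PTn x : P (Tn x) = Tn (P x) by rewrite /= PA PTm.
have fTm x : f (Tm x) = Tm (f x) by rewrite !TmE; elim: (n) => //= m <-; rewrite fA.
have fTn x : f (Tn x) = Tn (f x) by rewrite /= fA fTm.
have fK x : f (x - Tn x) = x by rewrite linearB fTn fT.
have Pf x : P (f x) = f (P x).
  have h : P (f x) - Tn (P (f x)) = P x by rewrite -PTn -linearB fT.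
  by rewrite -h fK.
have Pu x : P (x - P x) = 0 by rewrite linearB PP subrr.
have bf : bounded f.
  have [C [C0 hC]] := bP.
  exists (C + D * (3 / 4) ^+ k); split; first by rewrite ltr_wpDr// mulr_ge0 ?(ltW D0).
  move=> x; have h1 := nm_sub (f x) (P x); have h2 := fP x; have h3 := hC x.
  by clear -h1 h2 h3; lra.
pose Q : {linear X -> X} := idfun \- P.
have QE x : Q x = x - P x by [].
have bQ : bounded Q.
  have [C [C0 hC]] := bounded_add bounded_id (bounded_scale (-1) bP).
  by exists C; split => // x; have := hC x; rewrite /= scaleN1r.
(* [Z] is [A] on the kernel of [P] and the identity on its range; the Drazin inverse is
   [Z^-1 (1 - P)]. *)
pose Z : {linear X -> X} := (A \o Q) \+ P.
have ZE x : Z x = A (x - P x) + P x by [].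
have bZ : bijective Z.
  pose E : {linear X -> X} := (-1) \*: (f \o Q).
  have EE x : E x = - f (x - P x) by rewrite /= scaleN1r.
  pose W : {linear X -> X} := idfun \+ E.
  have WE x : W x = x - f (x - P x) by rewrite /= -EE.
  pose G : {linear X -> X} := ((-1) \*: (Tm \o (f \o Q))) \+ P.
  have GE x : G x = - Tm (f (x - P x)) + P x by rewrite /= scaleN1r.
  have Tnf y : A (Tm (f y)) = f y - y by rewrite -[X in _ = _ - X](fT y) /=; lmod.
  apply: (@bijective_comm _ _ Z G W) => [x|x|].
  - have PG : P (G x) = P x by rewrite GE linearD linearN PTm Pf Pu !linear0 add0r PP.
    rewrite ZE PG GE addrK linearN Tnf WE; lmod.
  - have PZ : P (Z x) = P x by rewrite ZE (linearD P) PA Pu linear0 add0r PP.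
    by rewrite GE PZ ZE addrK fA ATm Tnf WE; lmod.
  - apply: (@small_bijective _ _ W E) => // [|x].
      exact: bounded_scale (bounded_comp bf bQ).
    rewrite EE nmN; have := fP (x - P x); rewrite Pu subr0 => h.
    apply: (le_trans h); apply: (@le_trans _ _ (D * (3 / 4) ^+ k * ((1 + CP) * nm x))).
      rewrite ler_wpM2l ?mulr_ge0 ?(ltW D0)//.
      by have h3 := nmB x (P x); have h4 := hCP x; clear -h3 h4; lra.
    have h3 := ler_wpM2r (nm_ge0 x) small; have h4 := nm_ge0 x.
    by clear -h3 h4; lra.
have bbZ : bounded Z := bounded_add (bounded_comp bA bQ) bP.
have [B0 [ZK KZ bB0]] := bounded_inverse bbZ bZ.
have B0P x : B0 (P x) = P x.
  by rewrite -{2}[P x]ZK ZE PP subrr linear0 add0r.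
have PB0 x : P (B0 x) = P x.
  by rewrite -{2}[x]KZ ZE (linearD P) PA Pu linear0 add0r PP.
have B0A x : B0 (A x) = A (B0 x).
  rewrite -[A (B0 x)]ZK; congr (B0 _).
  by rewrite ZE PA -linearB -linearD -{1}[x]KZ ZE.
have AB x : A (B0 (x - P x)) = x - P x.
  by have := KZ (x - P x); rewrite ZE PB0 Pu subr0 addr0.
exists (B0 \o Q), (A \o P); split=> [|x|x|x|l l1] /=.
- exact: bounded_comp.
- by rewrite PA -linearB B0A.
- by rewrite AB Pu subr0.
- by rewrite AB opprB addrC subrK.
pose T : {linear X -> X} := A \o P; rewrite -/T.
have TE x : T x = A (P x) by [].
have it x : iter n.+1 T x = Tn (P x) by rewrite (iter_compl PP PA TE) TnE.
have l0 : l != 0 by apply/eqP => h; move: l1; rewrite h nm0 ler10.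
pose c := l ^+ n.+1; have c0 : c != 0 by rewrite expf_neq0.
have c1 : 1 <= nm c by rewrite nmX exprn_ege1.
(* [V = l^(n+1) - T^(n+1)] is a multiple of [T - l], so its bijectivity suffices; [nm c >= 1] bounds
   the factor [1 - c^-1] by 2. *)
pose V : {linear X -> X} := (c \*: idfun) \- (Tn \o P).
have VE x : V x = c *: x - Tn (P x) by [].
have bV : bijective V.
  pose G : {linear X -> X} := (f \o P) \+ Q.
  have GE x : G x = f (P x) + (x - P x) by [].
  pose E : {linear X -> X} := (1 - c^-1) \*: ((f \o P) \- P).
  have EE x : E x = (1 - c^-1) *: (f (P x) - P x) by [].
  pose W : {linear X -> X} := idfun \+ E.
  have WE x : W x = x + (1 - c^-1) *: (f (P x) - P x) by [].
  have Tnf y : Tn (f y) = f y - y by rewrite -[X in _ = _ - X](fT y); lmod.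
  apply: (@bijective_comm _ _ V G ((c \*: idfun) \o W)) => [x|x|].
  - have PG : P (G x) = f (P x) by rewrite GE linearD Pu Pf PP addr0.
    by rewrite VE PG Tnf GE [RHS]/=; lmod.
  - have PV : P (V x) = c *: P x - Tn (P x) by rewrite VE linearB linearZ PTn PP.
    rewrite GE PV VE linearB linearZ /= -/(Tn _) fTn Tnf [in RHS]/=; lmod.
  - apply: bij_comp; first exact: bijective_scale.
    apply: (@small_bijective _ _ W E) => // [|x].
      have [C [C0 hC]] := bounded_add (bounded_comp bf bP) (bounded_scale (-1) bP).
      apply: bounded_scale; exists C; split => // x; have := hC x.
      by rewrite /= scaleN1r.
    rewrite EE nmZ; have h := fP (P x); rewrite PP in h.
    have h2 : nm (1 - c^-1) <= 2.
      apply: (le_trans (nmB _ _)); rewrite nm1 nmV.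
      have h3 : (nm c)^-1 <= 1 by rewrite invf_le1// (lt_le_trans ltr01 c1).
      by clear -h3; lra.
    apply: (@le_trans _ _ (2 * (D * (3 / 4) ^+ k * (CP * nm x)))).
      apply: ler_pM; rewrite ?nm_ge0//; apply: (le_trans h).
      by rewrite ler_wpM2l ?mulr_ge0 ?(ltW D0).
    have h3 := ler_wpM2r (nm_ge0 x) small; have h4 := nm_ge0 x.
    have h5 : 0 <= D * (3 / 4) ^+ k * nm x by rewrite !mulr_ge0 ?(ltW D0) ?nm_ge0.
    by clear -h3 h4 h5; lra.
apply: inj_surj_bijective => [x|y].
  rewrite opshiftE => /eqP; rewrite subr_eq0 => /eqP Tx.
  have ix j : iter j T x = l ^+ j *: x.
    elim: j => [|j IH]; first by rewrite scale1r.
    by rewrite iterS IH linearZ [RHS]/= Tx /= scalerA -exprSr.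
  apply: (bij_inj bV); rewrite linear0 VE -it ix; exact: subrr.
have [g _ gK] := bV; have [z hz] := power_shift T l n.+1 (- g y).
have Vg : V (g y) = y by exact: gK.
exists z; rewrite opshiftE -hz it (linearN P) (linearN Tn) -/c -[RHS]Vg VE; lmod.
Qed.

Lemma radius_drazin A (r : R) : bounded A -> 0 < r ->
  (forall l, nm l = r -> bijective (opshift A l)) ->
  exists B T, [/\ bounded B, forall x, B (A x) = A (B x), forall x, B (A (B x)) = B x,
    forall x, T x = A (x - A (B x)) &
    forall l, r <= nm l -> bijective (opshift T l)].
Proof.
move=> bA r0 circle; pose c : R[i] := r%:C.
have nc : nm c = r by rewrite nm_real ?ltW.
have c0 : c != 0 by rewrite fmorph_eq0 gt_eqF.
pose A' : {linear X -> X} := c^-1 \*: A.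
have [|z z1|B [T [bB BA BAB TE bT]]] := @circle_drazin A'; first exact: bounded_scale.
  have z0 : z != 0 by apply/eqP => h; move: z1; rewrite h nm0; lra.
  have zc : - (z / c) != 0 by rewrite oppr_eq0 mulf_neq0 ?invr_eq0.
  have bz : bijective (opshift A (c / z)).
    by apply: circle; rewrite nmM nmV nc z1 invr1 mulr1.
  apply: (eq_bij (bij_comp (bijective_scale zc) bz)) => x /=.
  by rewrite /A' /=; lmod.
have BA' x : c^-1 *: B (A x) = c^-1 *: A (B x).
  by have := BA x; rewrite /A' /= linearZ.
have BA2 x : B (A x) = A (B x) by apply: (scalerI (invr_neq0 c0)); exact: BA'.
exists (c^-1 \*: B), (c \*: T); split=> [|x|x|x|l l1] /=.
- exact: bounded_scale.
- by rewrite BA2 linearZ.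
- by have := BAB x; rewrite /A' /= !linearZ /= => ->.
- have -> : A (c^-1 *: B x) = A' (B x) by rewrite /A' /= linearZ.
  by rewrite TE {1}/A' /= scalerA mulfV// scale1r.
have bl : bijective (opshift T (l / c)).
  by apply: bT; rewrite nmM nmV nc ler_pdivlMr// mul1r.
apply: (eq_bij (bij_comp (bijective_scale c0) bl)) => x /=.
by lmod.
Qed.

(* The radii at which the spectrum is met cannot accumulate at [r], since the
   corresponding spectral values would accumulate on the circle of radius [r]. *)
Lemma free_circle A (r : R) : bounded A -> 0 < r ->
  (forall l, nm l = r -> browderT (opshift A l)) ->
  forall e, 0 < e -> exists s, r < s < r + e /\
    forall l, nm l = s -> bijective (opshift A l).
Proof.
move=> bA r0 br e e0; apply: contrapT => n.
(* The offset 2 keeps all radii strictly below [r + e]. *)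
pose t (k : nat) : R := r + e / k.+2%:R.
have k2 (k : nat) : 2 <= k.+2%:R :> R by rewrite (ler_nat _ 2).
have tr k : r < t k < r + e.
  have := k2 k => hk; rewrite /t ltrDl divr_gt0//= ?ltrD2l ?ltr_pdivrMr; try lra.
  by rewrite -[ltLHS]mulr1 ltr_pM2l//; lra.
have /choice[u hu] : forall k, exists l, nm l = t k /\ ~ bijective (opshift A l).
  move=> k; apply: contrapT => h; apply: n; exists (t k); split => // l lk.
  by apply: contrapT => nb; apply: h; exists l.
have [k|l hl] := @bounded_cluster R u (r + e).
  by rewrite (hu k).1; have /andP[_ /ltW] := tr k.
have lr : nm l = r.
  have small d : 0 < d -> `|nm l - r| <= d.
    move=> d0; pose N := Num.bound (e / (d / 2)).
    have [|k [Nk uk]] := hl (d / 2) N; first lra.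
    have tk : t k - r <= d / 2.
      rewrite /t addrC addKr ler_pdivrMr; last by have := k2 k; lra.
      rewrite mulrC -ler_pdivrMr; last lra.
      apply: (@le_trans _ _ N%:R); last by rewrite ler_nat (leq_trans Nk)// ltnW.
      by apply/ltW/archi_boundP; rewrite divr_ge0 ?ltW//; lra.
    have := nm_sub l (u k); have := nm_sub (u k) l; rewrite (nmBC l) (hu k).1.
    have /andP[t1 _] := tr k; move=> h1 h2.
    by rewrite ler_norml; apply/andP; split; lra.
  apply/eqP; rewrite -subr_eq0 -normr_eq0 eq_le normr_ge0 andbT leNgt.
  by apply/negP => h; have := small (`|nm l - r| / 2) ltac:(lra); lra.
have [d [d0 hd]] := browder_resolvent_disc bA (br l lr).
have [k [_ uk]] := hl d 0%N d0; apply: (hu k).2; apply: hd.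
rewrite uk andbT nm_gt0// subr_eq0; apply/eqP => h.
by have /andP[+ _] := tr k; rewrite -(hu k).1 h lr ltxx.
Qed.

(** [T - l] agrees with [A - l] on the range of [P = 1 - A B] and is the nonzero scalar [- l] on its
    kernel; so its range can only grow and its kernel only shrink. *)
Lemma fredholm_compl A B T l : (forall x, B (A x) = A (B x)) ->
  (forall x, B (A (B x)) = B x) -> (forall x, T x = A (x - A (B x))) -> l != 0 ->
  fredholmT (opshift A l) -> fredholmT (opshift T l).
Proof.
move=> BA BAB TE l0 [fc fd].
pose P : {linear X -> X} := idfun \- (A \o B).
have PE x : P x = x - A (B x) by [].
clearbody P.
have PP x : P (P x) = P x.
  rewrite !PE; have -> : B (x - A (B x)) = 0 by rewrite linearB BAB subrr.
  by rewrite linear0 subr0.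
have PA x : P (A x) = A (P x) by rewrite !PE linearB BA.
have {}TE x : T x = A (P x) by rewrite TE PE.
split.
  apply: finite_codim_superset fc => _ [z _ <-]; rewrite opshiftE.
  set y := A z - l *: z.
  have Py : P y = A (P z) - l *: P z by rewrite /y linearB linearZ PA.
  pose w := P z - l^-1 *: (y - P y).
  have Pw : P w = P z by rewrite /w linearB linearZ /= linearB !PP subrr scaler0 subr0.
  exists w => //; rewrite opshiftE TE Pw.
  have -> : A (P z) = P y + l *: P z by rewrite Py subrK.
  by rewrite /w; lmod.
apply: finite_dim_subset fd => [|x /=]; first exact: is_subspace_ker.
move=> /eqP; rewrite subr_eq0 TE => /eqP h.
have Px : P x = x.
  by have := congr1 P h; rewrite PA PP linearZ /= h => /(scalerI l0) <-.
by rewrite -[in A x]Px h subrr.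
Qed.

End RieszDecomposition.

(** * Generalized Drazin-Riesz inverses *)

Section DrazinRiesz.
Context {R : realType} {X : completeNormedModType R[i]}.
Implicit Types (A : linop X) (S B T : {linear X -> X}) (l : R[i]).

Lemma bijective_fredholm S : bijective S -> fredholmT S.
Proof.
move=> [g gK Kg]; split.
  by apply/finite_codimP; exists [::] => x /=; exists (g x); rewrite ?Kg.
apply/finite_dimP; exists [::]; split => // x /= Sx.
by have := gK x; rewrite Sx => <-; have := gK 0; rewrite linear0.
Qed.

(** The classical Drazin inverse: [B x] is the unique [v] in [R(S^k)] with [S^(k+1) v = S^k x]. Then
    [T^(k+1) = 0]. *)
Lemma browder_drazin S : bounded S -> browderT S -> ~ finite_dim [set: X]%classic ->
  exists B T, [/\ bounded B, forall x, B (S x) = S (B x), forall x, B (S (B x)) = B x,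
    forall x, T x = S (x - S (B x)) &
    (forall l, l != 0 -> fredholmT (opshift T l)) /\ ~ fredholmT T].
Proof.
move=> bS brS dimX; have [k [C [cr C0 surV low]]] := browder_split bS brS.
have fcS : finite_codim (range S) by have [[]] := brS.
pose V := range (iter k S); have sV : is_subspace V := is_subspace_range_iter S k.
have SV x : V x -> V (S x) by exact: range_iter_S.
have [U [UE bU]] := iter_linear S k.
have VU x : V (U x) by rewrite UE; exists x.
have US x : U (S x) = S (U x) by rewrite !UE -iterSr.
have low_iter j x : V x -> nm x <= C ^+ j * nm (iter j S x).
  elim: j x => [|j IH] x Vx; first by rewrite expr0 mul1r.
  rewrite iterSr exprS -mulrA; apply: (le_trans (low x Vx)).
  by rewrite ler_wpM2l ?(ltW C0)// IH//; exact: SV.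
have inj x : V x -> S (U x) = 0 -> x = 0.
  move=> Vx h; apply: nm_eq0; apply/eqP; rewrite eq_le nm_ge0 andbT.
  by have := low_iter k.+1 x Vx; rewrite iterS -UE h nm0 mulr0.
have /choice[f hf] : forall x, exists v, V v /\ S (U v) = U x.
  move=> x; have surj j y : V y -> exists2 v, V v & iter j S v = y.
    elim: j y => [|j IH] y Vy; first by exists y.
    have [v Vv <-] := surV y Vy; have [w Vw <-] := IH v Vv.
    by exists w.
  by have [v Vv hv] := surj k.+1 (U x) (VU x); exists v; split; rewrite // UE -iterS hv.
have uniq v x : V v -> S (U v) = U x -> f x = v.
  move=> Vv hv; have [Vf hx] := hf x; apply/eqP; rewrite -subr_eq0; apply/eqP/inj.
    exact: is_subspaceB.
  by rewrite !linearB /= hx hv subrr.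
have [a x y|B BE] := mk_linear (f := f).
  have [Vx hx] := hf x; have [Vy hy] := hf y; apply: uniq; first exact: sV.2.
  by rewrite !linearP /= hx hy.
have VB x : V (B x) by rewrite BE; exact: (hf x).1.
have hB x : S (U (B x)) = U x by rewrite BE; exact: (hf x).2.
have {}uniq v x : V v -> S (U v) = U x -> B x = v by rewrite BE; exact: uniq.
have bB : bounded B.
  have [K [K0 hK]] := bU bS; exists (C ^+ k.+1 * K); split.
    by rewrite mulr_gt0// exprn_gt0.
  move=> x; apply: (le_trans (low_iter k.+1 (B x) (VB x))).
  by rewrite iterS -UE hB -mulrA ler_wpM2l// exprn_ge0// ltW.
have BS x : B (S x) = S (B x).
  by apply: uniq; [exact: SV|rewrite US hB US].
have BSB x : B (S (B x)) = B x.
  by apply: uniq; [exact: VB|rewrite US].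
pose P : {linear X -> X} := idfun \- (S \o B).
have PE x : P x = x - S (B x) by [].
clearbody P.
have BP x : B (P x) = 0 by rewrite PE linearB BSB subrr.
have PP x : P (P x) = P x by rewrite [LHS]PE BP linear0 subr0.
have PS x : P (S x) = S (P x) by rewrite !PE linearB BS.
have UP x : U (P x) = 0 by rewrite PE linearB US hB subrr.
pose T : {linear X -> X} := S \o P.
have TE x : T x = S (P x) by [].
clearbody T.
have nilT x : iter k.+1 T x = 0.
  by rewrite (iter_compl PP PS TE) iterS -UE UP linear0.
exists B, T; split => // [x|]; first by rewrite TE PE.
split=> [l l0|[fc fd]].
  apply/bijective_fredholm/inj_surj_bijective => [x|y]; last first.
    exact: (nilpotent_shift l0 (nilT y)).
  rewrite opshiftE => /eqP; rewrite subr_eq0 => /eqP Tx.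
  have ix j : iter j T x = l ^+ j *: x.
    elim: j => [|j IH]; first by rewrite scale1r.
    by rewrite iterS IH linearZ [LHS]/= Tx scalerA -exprSr.
  have := nilT x; rewrite ix => /eqP; rewrite scaler_eq0 expf_eq0 (negPf l0) andbF /=.
  by move/eqP.
(* [T] vanishes on [R(S^k)], of finite codimension, so a finite-dimensional kernel would make [X]
   finite-dimensional. *)
apply: dimX; apply: (finite_dim_codim fd).
have [s hs] := codim_range_iter k fcS.
apply: (@finite_codim_superset _ _ V); last by apply/finite_codimP; exists s.
move=> x Vx /=; have [v Vv Sv] := surV x Vx.
have Bx : B x = v by apply: uniq => //; rewrite -US Sv.
by rewrite TE PE Bx Sv subrr linear0.
Qed.

Lemma drazin_of_browder S (e : R) : bounded S -> 0 < e ->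
  (forall l, 0 < nm l < e -> browderT (opshift S l)) -> ~ finite_dim [set: X]%classic ->
  exists B T, [/\ bounded B, forall x, B (S x) = S (B x), forall x, B (S (B x)) = B x,
    forall x, T x = S (x - S (B x)) &
    (forall l, l != 0 -> fredholmT (opshift T l)) /\ ~ fredholmT T].
Proof.
move=> bS e0 he dimX; have [brS|nbr] := pselect (browderT S); first exact: browder_drazin.
have e3 : 0 < e / 3 by lra.
(* The circle is sought between the radii [e / 3] and [2 * e / 3], inside the punctured disc of
   Browder shifts. *)
have [l lr|s [/andP[rs sr] hs]] := free_circle bS e3 _ e3.
  by apply: he; rewrite lr; apply/andP; split; lra.
have s0 : 0 < s by lra.
have [B [T [bB BS BSB TE bT]]] := radius_drazin bS s0 hs.
exists B, T; split => //; split=> [l l0|[fc fd]].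
  have [sl|ls] := leP s (nm l); first exact/bijective_fredholm/bT.
  apply: (fredholm_compl BS BSB TE l0); have /he[//] : 0 < nm l < e.
  by rewrite nm_gt0//; lra.
(* The range of [T] lies in that of [S] and the kernel of [S] in that of [T], so a Fredholm [T]
   would make [S] Fredholm, hence Browder. *)
apply: nbr; apply: browder_limit => //; first split.
- by apply: finite_codim_superset fc => _ [x _ <-]; rewrite TE; exists (x - S (B x)).
- apply: finite_dim_subset fd => [|x /= Sx]; first exact: is_subspace_ker.
  by rewrite TE -BS Sx linear0 subr0.
(* The shift by [c] is Browder, so an invertible shift lies within [d - c] of it, hence within [d]
   of 0. *)
move=> d d0; pose c := Num.min d e / 2.
have c0 : 0 < c by rewrite divr_gt0// lt_min d0.
have cd : 2 * c <= d.
  have : Num.min d e <= d by rewrite ge_min lexx.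
  by rewrite /c; lra.
have ce : 2 * c <= e.
  have : Num.min d e <= e by rewrite ge_min lexx orbT.
  by rewrite /c; lra.
have nc : nm c%:C = c by rewrite nm_real// ltW.
have hc : 0 < nm c%:C < e by rewrite nc c0; lra.
have dc : 0 < d - c by lra.
have [b [bc bb]] := browder_near bS (he _ hc) dc.
by exists b; split => //; have := nm_sub b c%:C; rewrite nc; lra.
Qed.

Lemma drazin_riesz_intro A S B T : (forall x, dom A x) -> (forall x, A x = S x) ->
  bounded S -> bounded B -> (forall x, B (S x) = S (B x)) ->
  (forall x, B (S (B x)) = B x) -> (forall x, T x = S (x - S (B x))) ->
  (forall l, l != 0 -> fredholmT (opshift T l)) -> ~ fredholmT T -> gen_drazin_riesz A.
Proof.
move=> dA AS bS bB BS BSB TE fT nfT.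
have bT : bounded T.
  have [C [C0 hC]] := bounded_comp bS (bounded_add bounded_id
    (bounded_scale (-1) (bounded_comp bS bB))).
  by exists C; split => // x; have := hC x; rewrite /= scaleN1r TE.
exists B; split => //.
- exact/bounded_opP.
- by move=> x; rewrite AS.
- by split => // x _; rewrite !AS.
exists T; split=> [x|]; first by rewrite !AS.
split; first exact/bounded_opP.
have FE l : fredholm (op_shift (op_of_linear T) l) <-> fredholmT (opshift T l).
  by apply: fredholm_everywhere => //; exact: bounded_opshift.
have F0 : fredholm (op_shift (op_of_linear T) 0) <-> fredholmT T.
  by apply: fredholm_everywhere => // x; rewrite /= scale0r subr0.
apply/seteqP; split=> l /=.
  move=> nl; apply: contrapT => /eqP l0; apply: nl; exact/FE/fT.
by move=> ->; move/F0.
Qed.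

End DrazinRiesz.

Theorem theorem2p9 (R : realType) (X : completeNormedModType R[i])
    (X_infinite_dim : ~ finite_dim [set: X]%classic)
    (A : linop X) (A_hatC : hatC A) :
  gen_drazin_riesz A <-> ~ limit_point (sigma_b A) 0.
Proof.
have [S [bS dA AS]] := hatC_everywhere A_hatC.
have BE l : browder (op_shift A l) <-> browderT (opshift S l).
  apply: browder_everywhere => // [x|]; last exact: bounded_opshift.
  by rewrite /= AS.
split=> [[B [/bounded_opP bB _ BAB [_ BA] [T [TE rT]]]]|nl].
  have BS x : B (S x) = S (B x) by rewrite -!AS BA.
  have BSB x : B (S (B x)) = B x by rewrite -AS BAB.
  have TSE x : T x = S (x - S (B x)) by rewrite TE !AS.
  have [d [d0 hd]] := drazin_browder bS bB BS BSB TSE rT.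
  move=> /(_ (ball 0 d%:C)) []; first by apply: nbhsx_ballx; rewrite ltcR.
  move=> l [l0 nb]; rewrite -ball_normE /= sub0r normrN nmE ltcR => ld; apply: nb.
  by apply/BE/hd; rewrite nm_gt0.
have [e [e0 he]] : exists e : R, 0 < e /\
    forall l, 0 < nm l < e -> browderT (opshift S l).
  apply: contrapT => n; apply: nl => U /nbhs_ballP[c /= /gt0_complex[-> c0]] cU.
  apply: contrapT => nU; apply: n; exists (complex.Re c); split => // l /andP[l0 lc].
  apply/BE; apply: contrapT => nb; apply: nU; exists l; split => //.
    by apply/eqP => h; move: l0; rewrite h nm0 ltxx.
  by apply: cU; rewrite -ball_normE /= sub0r normrN nmE ltcR.
have [B [T [bB BS BSB TE [fT nfT]]]] := drazin_of_browder bS e0 he X_infinite_dim.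
exact: (drazin_riesz_intro dA AS bS bB BS BSB TE fT nfT).
Qed.
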